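(* Let $G$ be a group, $\mathfrak{X}$ a family of subgroups of $G$, $0\le n\le\infty$, and let $A$ be an $\mathcal{O}_{\mathfrak{X}}G$-module. Then the following are equivalent: (i) $A$ is of type Bredon-$\mathrm{FP}_n$. (ii) For every exact colimit, the natural homomorphism $$\varinjlim\operatorname{Ext}^k_{\mathfrak{X}}(A,M_* )\to\operatorname{Ext}^k_{\mathfrak{X}}(A,\varinjlim M_* )$$ is an isomorphism for all $k\le n-1$ and a monomorphism for $k=n$. (iii) For the direct limit of any directed system of $\mathcal{O}_{\mathfrak{X}}G$-modules $M_*$ with $\varinjlim M_*=0$, one has $\varinjlim\operatorname{Ext}^k_{\mathfrak{X}}(A,M_* )=0$ for all $k\le n$.
   Context: $\mathfrak{X}$ is a family of subgroups of $G$ (closed under conjugation). The orbit category $\mathcal{O}_{\mathfrak{X}}G$ has as objects the transitive $G$-sets with stabilisers in $\mathfrak{X}$ and as morphisms the $G$-maps. An $\mathcal{O}_{\mathfrak{X}}G$-module is a contravariant functor from $\mathcal{O}_{\mathfrak{X}}G$ to abelian groups; exactness, limits and colimits are defined pointwise. For a $G$-set $\Delta$ with stabilisers in $\mathfrak{X}$, $\mathbb{Z}[-,\Delta]$ is the module sending $\Gamma$ to the free abelian group on the set $[\Gamma,\Delta]$ of $G$-maps when $\Delta$ is transitive, extended to non-transitive $\Delta$ by direct sums over orbits. The modules $\mathbb{Z}[-,G/K]$, $K\in\mathfrak{X}$, are free, and direct sums of these are the free modules; there are enough projectives. A module is finitely generated if it is a quotient of $\mathbb{Z}[-,\Delta]$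 for some $\Delta$ with finitely many $G$-orbits. $\operatorname{Ext}^*_{\mathfrak{X}}(A,-)$ is computed as $H^*(\operatorname{Hom}_{\mathfrak{X}}(P_*,-))$ for a projective resolution $P_*\to A$, where $\operatorname{Hom}_{\mathfrak{X}}$ denotes natural transformations. A module $A$ is of type Bredon-$\mathrm{FP}_n$ if it has a projective resolution $P_*\to A$ with $P_i$ finitely generated for all $i\le n$ (for all $i$, if $n=\infty$). ''Exact colimit'' means a colimit $\varinjlim$ over a directed system $(M_\lambda)_{\lambda\in\Lambda}$ of $\mathcal{O}_{\mathfrak{X}}G$-modules (directed colimits are exact). *)

(* Defs.v *)
From HB Require Import structures.
From mathcomp Require Import all_boot all_order all_algebra.
From mathcomp Require Import boolp classical_sets functions cardinality.
From mathcomp Require Import freeg.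

Set Implicit Arguments.
Unset Strict Implicit.
Unset Printing Implicit Defensive.

Import Order.PreorderTheory GRing.Theory.

Local Open Scope ring_scope.
Local Open Scope quotient_scope.

Local Obligation Tactic := idtac.

(* MathComp's [groupType] cannot be used for G.  Every zmodType is turned into
   a groupType by [to_multiplicative], so the universe of groupType lies above
   that of zmodType; but Hom groups, whose elements are families indexed by
   all transitive G-sets, must be zmodTypes, so the universe of G has to lie
   strictly below that of zmodType. *)
Record grpType := GrpType {
  group_sort :> Type;
  gmul : group_sort -> group_sort -> group_sort;
  gone : group_sort;
  ginv : group_sort -> group_sort;
  gmulA : forall x y z, gmul x (gmul y z) = gmul (gmul x y) z;
  gmul1g : forall x, gmul gone x = x;
  gmulVg : forall x, gmul (ginv x) x = gone
}.

Declare Scope grp_scope.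
Delimit Scope grp_scope with grp.
Notation "x * y" := (gmul x y) : grp_scope.
Notation "x ^-1" := (ginv x) : grp_scope.
Notation "1" := (gone _) : grp_scope.

Definition is_subgroup (G : grpType) (H : G -> Prop) : Prop :=
  [/\ H 1%grp,
      forall x y, H x -> H y -> H (x * y)%grp
    & forall x, H x -> H (x^-1)%grp].

Record subgroup_family (G : grpType) := SubgroupFamily {
  family_mem :> (G -> Prop) -> Prop;
  family_subgroup : forall H, family_mem H -> is_subgroup H;
  family_conj : forall H (g : G), family_mem H ->
    family_mem (fun x => H (g^-1 * (x * g))%grp)
}.

Record gset (G : grpType) := GSet {
  gset_sort :> Type;
  gact : G -> gset_sort -> gset_sort;
  gact1 : forall x, gact 1%grp x = x;
  gactM : forall g h x, gact (g * h)%grp x = gact g (gact h x)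
}.

Definition gstab (G : grpType) (D : gset G) (x : D) : G -> Prop :=
  fun g => gact g x = x.

Definition gtransitive (G : grpType) (D : gset G) : Prop :=
  inhabited D /\ forall x y : D, exists g, gact g x = y.

Definition stab_in (G : grpType) (X : subgroup_family G) (D : gset G) : Prop :=
  forall x : D, X (gstab x).

Record gmap (G : grpType) (C D : gset G) := GMap {
  gmap_fun :> C -> D;
  gmap_act : forall g x, gmap_fun (gact g x) = gact g (gmap_fun x)
}.

HB.instance Definition _ G (C D : gset G) := gen_eqMixin (gmap C D).
HB.instance Definition _ G (C D : gset G) := gen_choiceMixin (gmap C D).

Lemma gmapP G (C D : gset G) (f g : gmap C D) : f =1 g -> f = g.
Proof.
case: f g => f fP [g gP] /= /funext fg; rewrite fg in fP *.
by congr GMap; exact: Prop_irrelevance.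
Qed.

Definition gid G (D : gset G) : gmap D D :=
  @GMap G D D id (fun g x => erefl).

Lemma gcomp_act G (B C D : gset G) (f : gmap C D) (e : gmap B C) g x :
  f (e (gact g x)) = gact g (f (e x)).
Proof. by rewrite !gmap_act. Qed.

Definition gcomp G (B C D : gset G) (f : gmap C D) (e : gmap B C) : gmap B D :=
  GMap (gcomp_act f e).

(* Objects of the orbit category; the morphisms are the G-maps. *)
Record orb (G : grpType) (X : subgroup_family G) := Orb {
  orb_set :> gset G;
  orb_trans : gtransitive orb_set;
  orb_stab : stab_in X orb_set
}.

Section Modules.
Variables (G : grpType) (X : subgroup_family G).

Record omod := OMod {
  om_obj :> orb X -> zmodType;
  om_res : forall C D : orb X, gmap C D -> om_obj D -> om_obj C;
  om_resD : forall (C D : orb X) (f : gmap C D), {morph om_res f : x y / x + y};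
  om_res1 : forall (D : orb X) x, om_res (gid D) x = x;
  om_resM : forall (B C D : orb X) (f : gmap C D) (e : gmap B C) x,
    om_res (gcomp f e) x = om_res e (om_res f x)
}.

Record ohom (M N : omod) := OHom {
  oh_fun :> forall D : orb X, M D -> N D;
  oh_funD : forall D, {morph @oh_fun D : x y / x + y};
  oh_nat : forall (C D : orb X) (f : gmap C D) x,
    @oh_fun C (om_res f x) = om_res f (@oh_fun D x)
}.

End Modules.

Arguments oh_fun {G X M N} _ D x.
Arguments oh_funD {G X M N} _ D x y.

Lemma morphD_zmod (U V : zmodType) (f : U -> V) :
  {morph f : x y / x + y} -> zmod_morphism f.
Proof.
by move=> fD x y; apply: (addIr (f y)); rewrite -fD !addrNK.
Qed.

HB.instance Definition _ G (X : subgroup_family G) (M : omod X) (C D : orb X)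
    (f : gmap C D) :=
  GRing.isZmodMorphism.Build (M D) (M C) (om_res f) (morphD_zmod (om_resD f)).

HB.instance Definition _ G (X : subgroup_family G) (M N : omod X) (f : ohom M N)
    (D : orb X) :=
  GRing.isZmodMorphism.Build (M D) (N D) (f D) (morphD_zmod (oh_funD f D)).

Section HomGroup.
Variables (G : grpType) (X : subgroup_family G).
Implicit Types M N : omod X.

Lemma ohomP M N (f g : ohom M N) : (forall D x, f D x = g D x) -> f = g.
Proof.
case: f g => f fD fN [g gD gN] /= fg.
have {}fg : f = g.
  by apply: functional_extensionality_dep => D; apply: funext => x; apply: fg.
by subst g; congr OHom; exact: Prop_irrelevance.
Qed.

HB.instance Definition _ M N := gen_eqMixin (ohom M N).
HB.instance Definition _ M N := gen_choiceMixin (ohom M N).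

Program Definition ohom0 M N : ohom M N := @OHom G X M N (fun _ _ => 0) _ _.
Next Obligation. by move=> M N D x y /=; rewrite addr0. Qed.
Next Obligation. by move=> M N C D f x /=; rewrite raddf0. Qed.

Program Definition ohom_opp M N (f : ohom M N) : ohom M N :=
  @OHom G X M N (fun D x => - f D x) _ _.
Next Obligation. by move=> M N f D x y /=; rewrite raddfD opprD. Qed.
Next Obligation. by move=> M N f C D e x /=; rewrite oh_nat raddfN. Qed.

Program Definition ohom_add M N (f g : ohom M N) : ohom M N :=
  @OHom G X M N (fun D x => f D x + g D x) _ _.
Next Obligation. by move=> M N f g D x y /=; rewrite !raddfD addrACA. Qed.
Next Obligation. by move=> M N f g C D e x /=; rewrite !oh_nat raddfD. Qed.

Fact ohom_addA M N : associative (@ohom_add M N).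
Proof. by move=> f g h; apply: ohomP => D x /=; rewrite addrA. Qed.
Fact ohom_addC M N : commutative (@ohom_add M N).
Proof. by move=> f g; apply: ohomP => D x /=; rewrite addrC. Qed.
Fact ohom_add0 M N : left_id (@ohom0 M N) (@ohom_add M N).
Proof. by move=> f; apply: ohomP => D x /=; rewrite add0r. Qed.
Fact ohom_addN M N : left_inverse (@ohom0 M N) (@ohom_opp M N) (@ohom_add M N).
Proof. by move=> f; apply: ohomP => D x /=; rewrite addNr. Qed.

HB.instance Definition _ M N := GRing.isZmodule.Build (ohom M N)
  (@ohom_addA M N) (@ohom_addC M N) (@ohom_add0 M N) (@ohom_addN M N).

Program Definition oid M : ohom M M := @OHom G X M M (fun _ x => x) _ _.
Next Obligation. by []. Qed.
Next Obligation. by []. Qed.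

Program Definition ocomp L M N (g : ohom M N) (f : ohom L M) : ohom L N :=
  @OHom G X L N (fun D x => g D (f D x)) _ _.
Next Obligation. by move=> L M N g f D x y /=; rewrite !raddfD. Qed.
Next Obligation. by move=> L M N g f C D e x /=; rewrite !oh_nat. Qed.

Definition osurj M N (f : ohom M N) : Prop :=
  forall D (y : N D), exists x, f D x = y.

Definition oexact L M N (f : ohom L M) (g : ohom M N) : Prop :=
  forall D (y : M D), g D y = 0 <-> exists x, f D x = y.

Definition ozero M : Prop := forall D (x : M D), x = 0.

Definition projective (P : omod X) : Prop :=
  forall M N (e : ohom M N) (f : ohom P N), osurj e ->
    exists g : ohom P M, ocomp e g = f.

End HomGroup.

Section DirectSum.
Variables (I : Type) (V : I -> zmodType).

(* The direct sum of the V i: families with finite support. *)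
Record dsum := DSum {
  ds_fun :> forall i, V i;
  ds_fin : finite_set [set i | ds_fun i != 0]%classic
}.

Lemma dsumP (x y : dsum) : (forall i, x i = y i) -> x = y.
Proof.
case: x y => x xP [y yP] /= xy.
have {}xy : x = y by apply: functional_extensionality_dep.
by subst y; congr DSum; exact: Prop_irrelevance.
Qed.

HB.instance Definition _ := gen_eqMixin dsum.
HB.instance Definition _ := gen_choiceMixin dsum.

Program Definition dsum0 : dsum := @DSum (fun=> 0) _.
Next Obligation.
apply: (sub_finite_set _ (finite_set0 I)) => i /=.
by rewrite eqxx.
Qed.

Program Definition dsum_opp (x : dsum) : dsum := @DSum (fun i => - x i) _.
Next Obligation.
move=> x; apply: (sub_finite_set _ (ds_fin x)) => i /=.
by rewrite oppr_eq0.
Qed.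

Program Definition dsum_add (x y : dsum) : dsum := @DSum (fun i => x i + y i) _.
Next Obligation.
move=> x y.
have : finite_set ([set i | x i != 0] `|` [set i | y i != 0])%classic.
  by rewrite finite_setU; split; exact: ds_fin.
apply: sub_finite_set => i /=.
case: (eqVneq (x i) 0) => [->|]; last by left.
by rewrite add0r; right.
Qed.

Fact dsum_addA : associative dsum_add.
Proof. by move=> x y z; apply: dsumP => i /=; rewrite addrA. Qed.
Fact dsum_addC : commutative dsum_add.
Proof. by move=> x y; apply: dsumP => i /=; rewrite addrC. Qed.
Fact dsum_add0 : left_id dsum0 dsum_add.
Proof. by move=> x; apply: dsumP => i /=; rewrite add0r. Qed.
Fact dsum_addN : left_inverse dsum0 dsum_opp dsum_add.
Proof. by move=> x; apply: dsumP => i /=; rewrite addNr. Qed.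

HB.instance Definition _ :=
  GRing.isZmodule.Build dsum dsum_addA dsum_addC dsum_add0 dsum_addN.

End DirectSum.

Section FreeGroup.
Variables (K : choiceType) (V : zmodType).

(* The additive extension of a map f defined on the basis K. *)
Definition flift (f : K -> V) (x : {freeg K / int}) : V :=
  @fglift int (ssrint.zmodule V) K f x.

HB.instance Definition _ f :=
  GRing.isZmodMorphism.Build {freeg K / int} V (flift f)
    (@lift_is_additive int K (ssrint.zmodule V) f).

Lemma fliftU f k : flift f << k >> = f k.
Proof. by rewrite /flift liftU scale1r. Qed.

Lemma freeg_ext (f g : {freeg K / int} -> V) :
  {morph f : x y / x + y} -> {morph g : x y / x + y} ->
  (forall k, f << k >> = g << k >>) -> f =1 g.
Proof.
move=> /morphD_zmod fD /morphD_zmod gD fg x.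
pose fA := GRing.isZmodMorphism.Build _ _ f fD.
pose F : {additive {freeg K / int} -> V} := HB.pack f fA.
pose gA := GRing.isZmodMorphism.Build _ _ g gD.
pose E : {additive {freeg K / int} -> V} := HB.pack g gA.
rewrite -[f]/(F : _ -> _) -[g]/(E : _ -> _) -[x]freeg_sumE !raddf_sum.
apply: eq_bigr => k _.
have -> : << coeff k x *g k >> = << k >> *~ coeff k x :> {freeg K / int}.
  by rewrite freegU_mulz intz.
by rewrite !raddfMz /= fg.
Qed.

End FreeGroup.

Section FreeModules.
Variables (G : grpType) (X : subgroup_family G).

(* Z[-,D] for a transitive D *)
Section Representable.
Variable D : orb X.

Definition zrep_res (B C : orb X) (e : gmap B C) :
    {freeg (gmap C D) / int} -> {freeg (gmap B D) / int} :=
  flift (fun f : gmap C D => << gcomp f e >>).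

Program Definition zrep : omod X :=
  @OMod G X (fun C => {freeg (gmap C D) / int}) zrep_res _ _ _.
Next Obligation. by move=> B C e x y; rewrite /zrep_res raddfD. Qed.
Next Obligation.
move=> C; apply: freeg_ext => // [x y|f]; first by rewrite /zrep_res raddfD.
by rewrite /zrep_res fliftU; congr << _ >>; exact: gmapP.
Qed.
Next Obligation.
move=> A B C f e; apply: freeg_ext => [x y|x y|h]; rewrite /zrep_res ?raddfD//.
by rewrite !fliftU; congr << _ >>; exact: gmapP.
Qed.

End Representable.

Program Definition osum (I : Type) (M : I -> omod X) : omod X :=
  @OMod G X (fun D => dsum (fun i => M i D))
    (fun C D e x => @DSum _ _ (fun i => om_res e (x i)) _) _ _ _.
Next Obligation.
move=> I M C D e x; apply: (sub_finite_set _ (ds_fin x)) => i /=.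
by apply: contra => /eqP ->; rewrite raddf0.
Qed.
Next Obligation. by move=> I M C D e x y; apply: dsumP => i /=; rewrite raddfD. Qed.
Next Obligation. by move=> I M D x; apply: dsumP => i /=; rewrite om_res1. Qed.
Next Obligation. by move=> I M B C D f e x; apply: dsumP => i /=; rewrite om_resM. Qed.

Definition orbits (D : gset G) : Type :=
  {O : D -> Prop | exists x, O = fun y => exists g, gact g x = y}.

Section OrbitSet.
Variables (D : gset G) (O : orbits D).

Lemma orbit_act g (x : D) : sval O x -> sval O (gact g x).
Proof.
have [x0 ->] := svalP O => -[h <-]; exists (g * h)%grp.
by rewrite gactM.
Qed.

Program Definition orbit_set : gset G :=
  @GSet G {x : D | sval O x} (fun g x => exist _ (gact g (sval x)) _) _ _.
Next Obligation. by move=> g [x Ox] /=; exact: orbit_act. Qed.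
Next Obligation. by move=> [x Ox]; apply: eq_exist => /=; rewrite gact1. Qed.
Next Obligation. by move=> g h [x Ox]; apply: eq_exist => /=; rewrite gactM. Qed.

Lemma orbit_trans : gtransitive orbit_set.
Proof.
have [x0 Ox0] := svalP O; split.
  have Px0 : sval O x0 by rewrite Ox0; exists 1%grp; rewrite gact1.
  by constructor; exists x0.
move=> [x Px] [y Py].
have [g gx] : exists g, gact g x0 = x by move: (Px); rewrite Ox0.
have [h hy] : exists h, gact h x0 = y by move: (Py); rewrite Ox0.
exists (h * g^-1)%grp; apply: eq_exist => /=.
by rewrite gactM -gx -(gactM g^-1%grp g) gmulVg gact1.
Qed.

Lemma orbit_stab : stab_in X D -> stab_in X orbit_set.
Proof.
move=> XD x; have := XD (sval x).
congr (family_mem X); apply: funext => g; apply: propext; split.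
  by case: x => x Ox /= gx; apply: eq_exist.
by move=> /(congr1 sval).
Qed.

End OrbitSet.

Definition orbit_orb (D : gset G) (XD : stab_in X D) (O : orbits D) : orb X :=
  Orb (@orbit_trans D O) (@orbit_stab D O XD).

(* Z[-,D] for an arbitrary G-set D with stabilisers in X *)
Definition zmodset (D : gset G) (XD : stab_in X D) : omod X :=
  osum (fun O : orbits D => zrep (orbit_orb XD O)).

Definition finitely_generated (M : omod X) : Prop :=
  exists (D : gset G) (XD : stab_in X D),
    finite_set [set: orbits D]%classic /\
    exists e : ohom (zmodset XD) M, osurj e.

End FreeModules.

Section Resolutions.
Variables (G : grpType) (X : subgroup_family G).

Record proj_res (A : omod X) := ProjRes {
  pr_obj :> nat -> omod X;
  pr_d : forall k, ohom (pr_obj k.+1) (pr_obj k);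
  pr_aug : ohom (pr_obj 0) A;
  pr_proj : forall k, projective (pr_obj k);
  pr_surj : osurj pr_aug;
  pr_exact0 : oexact (pr_d 0) pr_aug;
  pr_exact : forall k, oexact (pr_d k.+1) (pr_d k)
}.

(* [None] stands for infinity. *)
Definition leq_ext (k : nat) (n : option nat) : bool :=
  if n is Some m then (k <= m)%N else true.

Definition ltn_ext (k : nat) (n : option nat) : bool :=
  if n is Some m then (k < m)%N else true.

Definition bredon_FP (n : option nat) (A : omod X) : Prop :=
  exists P : proj_res A,
    forall i, leq_ext i n -> finitely_generated (P i).

End Resolutions.

(* Every module has a projective resolution. *)
Section Existence.
Variables (G : grpType) (X : subgroup_family G).

Record free_gen (M : omod X) (C : orb X) := FreeGen {
  fg_orb : orb X;
  fg_elt : M fg_orb;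
  fg_map : gmap C fg_orb
}.

HB.instance Definition _ M C := gen_eqMixin (free_gen M C).
HB.instance Definition _ M C := gen_choiceMixin (free_gen M C).

Definition free_gen_res (M : omod X) (B C : orb X) (e : gmap B C) (s : free_gen M C) :
  free_gen M B := FreeGen (fg_elt s) (gcomp (fg_map s) e).

(* The direct sum of copies of Z[-,D] indexed by all pairs (D, x : M D) *)
Program Definition free_cover (M : omod X) : omod X :=
  @OMod G X (fun C => {freeg (free_gen M C) / int})
    (fun B C e => flift (fun s => << free_gen_res e s >>)) _ _ _.
Next Obligation. by move=> M B C e x y /=; rewrite raddfD. Qed.
Next Obligation.
move=> M C; apply: freeg_ext => // [x y|[D x f]] /=; first by rewrite raddfD.
rewrite fliftU; congr << _ >>; congr FreeGen; exact: gmapP.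
Qed.
Next Obligation.
move=> M A B C f e; apply: freeg_ext => [x y|x y|[D x h]] /=; rewrite ?raddfD//.
rewrite !fliftU; congr << _ >>; congr FreeGen; exact: gmapP.
Qed.

Section Lift.
Variables (M N : omod X) (v : forall D, M D -> N D).

Program Definition free_lift : ohom (free_cover M) N :=
  @OHom G X (free_cover M) N
    (fun C => flift (fun s : free_gen M C => om_res (fg_map s) (v (fg_elt s)))) _ _.
Next Obligation. by move=> C x y /=; rewrite raddfD. Qed.
Next Obligation.
move=> B C e; apply: freeg_ext => [x y|x y|s] /=; rewrite ?raddfD//.
by rewrite !fliftU /= om_resM.
Qed.

Lemma free_liftU C s : free_lift C << s >> = om_res (fg_map s) (v (fg_elt s)).
Proof. by rewrite /= fliftU. Qed.

End Lift.

Definition free_gen1 (M : omod X) (D : orb X) (x : M D) : free_cover M D :=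
  << FreeGen x (gid D) >>.

Lemma free_cover_ext (M N : omod X) (f g : ohom (free_cover M) N) :
  (forall D x, f D (free_gen1 x) = g D (free_gen1 x)) -> f = g.
Proof.
move=> fg; apply: ohomP => C.
apply: freeg_ext => [x y|x y|[D x h]]; rewrite ?raddfD//.
have -> : << FreeGen x h >> = om_res h (free_gen1 x) :> free_cover M C.
  by rewrite /= fliftU; congr << _ >>; congr FreeGen; exact: gmapP.
by rewrite !oh_nat fg.
Qed.

Lemma free_cover_proj M : projective (free_cover M).
Proof.
move=> N N' e f esurj.
pose v D (x : M D) := projT1 (cid (esurj D (f D (free_gen1 x)))).
exists (free_lift v); apply: free_cover_ext => D x.
rewrite /= fliftU /= om_res1 /v.
by case: cid.
Qed.

Definition free_cover_map M : ohom (free_cover M) M :=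
  @free_lift M M (fun D x => x).

Lemma free_cover_surj M : osurj (free_cover_map M).
Proof. by move=> D y; exists (free_gen1 y); rewrite /= fliftU /= om_res1. Qed.

Section Kernel.
Variables (M N : omod X) (f : ohom M N).

Definition ker_pred D : {pred M D} := fun x => f D x == 0.

Fact ker_closed D : zmod_closed (@ker_pred D).
Proof.
split; first by apply/eqP; rewrite raddf0.
by move=> x y /eqP x0 /eqP y0; apply/eqP; rewrite raddfB /= x0 y0 subrr.
Qed.

HB.instance Definition _ D :=
  GRing.isZmodClosed.Build (M D) (@ker_pred D) (@ker_closed D).

Record ker_elt D := KerElt { ker_val :> M D; ker_valP : ker_val \in @ker_pred D }.

HB.instance Definition _ D := [isSub for @ker_val D].
HB.instance Definition _ D := [Choice of ker_elt D by <:].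
HB.instance Definition _ D := [SubChoice_isSubZmodule of ker_elt D by <:].

Fact ker_res_proof (C D : orb X) (e : gmap C D) (x : ker_elt D) :
  om_res e (ker_val x) \in @ker_pred C.
Proof. by apply/eqP; rewrite oh_nat (eqP (ker_valP x)) raddf0. Qed.

Program Definition oker : omod X :=
  @OMod G X (fun D => ker_elt D) (fun C D e x => KerElt (ker_res_proof e x)) _ _ _.
Next Obligation. by move=> C D e x y; apply: val_inj; rewrite /= raddfD. Qed.
Next Obligation. by move=> D x; apply: val_inj; rewrite /= om_res1. Qed.
Next Obligation. by move=> B C D g e x; apply: val_inj; rewrite /= om_resM. Qed.

Program Definition oker_in : ohom oker M :=
  @OHom G X oker M (fun D x => ker_val x) _ _.
Next Obligation. by []. Qed.
Next Obligation. by []. Qed.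

End Kernel.

Fixpoint syzygy (A : omod X) (k : nat) : omod X :=
  if k is j.+1 then oker (free_cover_map (syzygy A j)) else A.

Definition free_res_d (A : omod X) (k : nat) :
    ohom (free_cover (syzygy A k.+1)) (free_cover (syzygy A k)) :=
  ocomp (oker_in (free_cover_map (syzygy A k))) (free_cover_map (syzygy A k.+1)).

Lemma free_res_exact A k : oexact (free_res_d A k) (free_cover_map (syzygy A k)).
Proof.
move=> D y; split=> [/eqP y0|[x <-]]; last first.
  exact/eqP/(ker_valP (free_cover_map (syzygy A k.+1) D x)).
have [x xy] := @free_cover_surj (syzygy A k.+1) D (KerElt y0).
by exists x; rewrite [LHS](congr1 (@ker_val _ _ _ _) xy).
Qed.

Definition free_res (A : omod X) : proj_res A.
Proof.
apply: (@ProjRes G X A (fun k => free_cover (syzygy A k)) (free_res_d A)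
  (free_cover_map A)).
- by move=> k; exact: free_cover_proj.
- exact: free_cover_surj.
- exact: (@free_res_exact A 0).
move=> k D y; rewrite -free_res_exact /=; split=> [y0|y0].
  by apply: val_inj.
by rewrite -[RHS](congr1 (@ker_val _ _ _ _) y0).
Defined.

End Existence.

Section Ext.
Variables (G : grpType) (X : subgroup_family G) (A : omod X) (P : proj_res A).
Implicit Types (k : nat) (M N : omod X).

Definition cocycle k M : {pred ohom (P k) M} :=
  fun f => ocomp f (pr_d P k) == 0.

Fact cocycle_closed k M : zmod_closed (@cocycle k M).
Proof.
split; first by apply/eqP; apply: ohomP.
move=> f g /eqP f0 /eqP g0; apply/eqP; apply: ohomP => D x /=.
have /= -> := congr1 (fun h => oh_fun h D x) f0.
have /= -> := congr1 (fun h => oh_fun h D x) g0.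
by rewrite subr0.
Qed.

HB.instance Definition _ k M :=
  GRing.isZmodClosed.Build (ohom (P k) M) (@cocycle k M) (@cocycle_closed k M).

Record cocycles k M := Cocycle {
  cocycle_val :> ohom (P k) M;
  cocycleP : cocycle_val \in @cocycle k M
}.

HB.instance Definition _ k M := [isSub for @cocycle_val k M].
HB.instance Definition _ k M := [Choice of cocycles k M by <:].
HB.instance Definition _ k M := [SubChoice_isSubZmodule of cocycles k M by <:].

Definition coboundary k : forall M, {pred cocycles k M} :=
  match k with
  | 0 => fun M z => z == 0
  | j.+1 => fun M z =>
      `[< exists g : ohom (P j) M, ocomp g (pr_d P j) = cocycle_val z >]
  end.

Fact coboundary_closed k M : zmod_closed (@coboundary k M).
Proof.
case: k => [|k]; split.
- exact: eqxx.
- by move=> x y /eqP -> /eqP ->; rewrite subr0; exact: eqxx.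
- by apply/asboolP; exists 0; apply: ohomP.
move=> x y /asboolP[f fx] /asboolP[g gy]; apply/asboolP; exists (f - g).
by rewrite [RHS]/= -fx -gy; apply: ohomP.
Qed.

HB.instance Definition _ k M :=
  GRing.isZmodClosed.Build (cocycles k M) (@coboundary k M)
    (@coboundary_closed k M).

(* Ext^k(A,M), computed from the projective resolution P of A *)
Definition ext k M : zmodType := Quotient.quot (@coboundary k M).

Definition ext_class k M (z : cocycles k M) : ext k M :=
  \pi_(Quotient.quot (@coboundary k M)) z.

Lemma ext_classP k M (y z : cocycles k M) :
  ext_class y = ext_class z <-> y - z \in @coboundary k M.
Proof.
rewrite /ext_class; split=> [/eqmodP|yz]; first by [].
by apply/eqmodP.
Qed.

Lemma ext_classD k M : {morph @ext_class k M : y z / y + z}.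
Proof. by move=> y z; rewrite /ext_class !piE. Qed.

Lemma ext_class_surj k M (x : ext k M) : exists z, x = ext_class z.
Proof.
by exists (repr (x : Quotient.quot (@coboundary k M))); rewrite /ext_class reprK.
Qed.

Section Functor.
Variables (M N : omod X) (h : ohom M N).

Fact cocycle_map_proof k (z : cocycles k M) :
  ocomp h (cocycle_val z) \in @cocycle k N.
Proof.
have /eqP z0 := cocycleP z; apply/eqP; apply: ohomP => D x /=.
by have /= -> := congr1 (fun f => oh_fun f D x) z0; rewrite raddf0.
Qed.

Definition cocycle_map k (z : cocycles k M) : cocycles k N :=
  Cocycle (cocycle_map_proof z).

Definition ext_map k (x : ext k M) : ext k N :=
  ext_class (cocycle_map (repr (x : Quotient.quot (@coboundary k M)))).

Lemma cocycle_mapB k (y z : cocycles k M) :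
  cocycle_map (y - z) = cocycle_map y - cocycle_map z.
Proof. by apply: val_inj; apply: ohomP => D x /=; rewrite raddfB. Qed.

Lemma cocycle_mapD k (y z : cocycles k M) :
  cocycle_map (y + z) = cocycle_map y + cocycle_map z.
Proof. by apply: val_inj; apply: ohomP => D x /=; rewrite raddfD. Qed.

Lemma cocycle_map_coboundary k (z : cocycles k M) :
  z \in @coboundary k M -> cocycle_map z \in @coboundary k N.
Proof.
case: k z => [|j] z.
  move=> /eqP ->; apply/eqP; apply: val_inj; apply: ohomP => D x /=.
  by rewrite raddf0.
move=> /asboolP[g gz]; apply/asboolP; exists (ocomp h g).
by rewrite /= -gz; apply: ohomP.
Qed.

Lemma ext_mapE k (z : cocycles k M) : ext_map (ext_class z) = ext_class (cocycle_map z).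
Proof.
apply/ext_classP; rewrite -cocycle_mapB; apply: cocycle_map_coboundary.
by apply/ext_classP; rewrite /ext_class reprK.
Qed.

Lemma ext_mapD k : {morph @ext_map k : x y / x + y}.
Proof.
move=> x y; have [u ->] := ext_class_surj x; have [v ->] := ext_class_surj y.
by rewrite -ext_classD !ext_mapE cocycle_mapD ext_classD.
Qed.

End Functor.

Lemma ext_map_id k M (x : ext k M) : ext_map (oid M) x = x.
Proof.
have [z ->] := ext_class_surj x; rewrite ext_mapE; congr ext_class.
by apply: val_inj; apply: ohomP.
Qed.

Lemma ext_map_comp k L M N (g : ohom M N) (f : ohom L M) (x : ext k L) :
  ext_map (ocomp g f) x = ext_map g (ext_map f x).
Proof.
have [z ->] := ext_class_surj x; rewrite !ext_mapE; congr ext_class.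
by apply: val_inj; apply: ohomP.
Qed.

End Ext.

Arguments ext_class {G X A P k M} z.
Arguments ext_map {G X A P M N} h {k} x.

(* Nonempty directed index sets *)
Record dirset := DirSet {
  dir_disp : Order.disp_t;
  dir_sort :> preorderType dir_disp;
  dir_inhab : inhabited dir_sort;
  dir_ub : forall i j : dir_sort, exists k, (i <= k)%O /\ (j <= k)%O
}.

Record zsys (L : dirset) := ZSys {
  zs_obj :> L -> zmodType;
  zs_map : forall i j, (i <= j)%O -> zs_obj i -> zs_obj j;
  zs_mapD : forall i j (ij : (i <= j)%O), {morph zs_map ij : x y / x + y};
  zs_map1 : forall i (ii : (i <= i)%O) x, zs_map ii x = x;
  zs_mapM : forall i j k (ij : (i <= j)%O) (jk : (j <= k)%O) (ik : (i <= k)%O) x,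
    zs_map ik x = zs_map jk (zs_map ij x)
}.

HB.instance Definition _ (L : dirset) (S : zsys L) (i j : L) (ij : (i <= j)%O) :=
  GRing.isZmodMorphism.Build (S i) (S j) (zs_map ij) (morphD_zmod (zs_mapD ij)).

Section DirectLimit.
Variables (L : dirset) (S : zsys L).

(* Two elements of the disjoint union of the groups S i are identified when
   they become equal at a later stage. *)
Definition dlim_rel (p q : {i : L & S i}) : bool :=
  `[< exists k (pk : (tag p <= k)%O) (qk : (tag q <= k)%O),
        zs_map pk (tagged p) = zs_map qk (tagged q) >].

Fact dlim_rel_refl : reflexive dlim_rel.
Proof. by move=> p; apply/asboolP; exists (tag p), (lexx _), (lexx _). Qed.

Fact dlim_rel_sym : symmetric dlim_rel.
Proof.
by move=> p q; apply/asboolP/asboolP => -[k [a [b ab]]]; exists k, b, a.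
Qed.

Fact dlim_rel_trans : transitive dlim_rel.
Proof.
move=> q p r /asboolP[k [a [b ab]]] /asboolP[l [c [d cd]]]; apply/asboolP.
have [m [km lm]] := dir_ub k l.
exists m, (le_trans a km), (le_trans d lm).
rewrite (zs_mapM a km) ab -(zs_mapM b km (le_trans b km)).
by rewrite (zs_mapM d lm) -cd -(zs_mapM c lm (le_trans b km)).
Qed.

Canonical dlim_equiv : equiv_rel {i : L & S i} :=
  EquivRel dlim_rel dlim_rel_refl dlim_rel_sym dlim_rel_trans.

Definition dlim := {eq_quot dlim_rel}.

HB.instance Definition _ : EqQuotient {i : L & S i} dlim_rel dlim :=
  EqQuotient.on dlim.
HB.instance Definition _ := Choice.on dlim.

(* The canonical map S i -> lim S *)
Definition dlim_in (i : L) (x : S i) : dlim :=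
  \pi_dlim (Tagged (fun i => S i) x).

Lemma dlim_inP i j (x : S i) (y : S j) :
  dlim_in x = dlim_in y <->
  exists k (ik : (i <= k)%O) (jk : (j <= k)%O), zs_map ik x = zs_map jk y.
Proof.
rewrite /dlim_in; split=> [/eqmodP/asboolP //|xy].
by apply/eqmodP/asboolP.
Qed.

Lemma dlim_surj (a : dlim) : exists i (x : S i), a = dlim_in x.
Proof.
exists (tag (repr a)), (tagged (repr a)); rewrite /dlim_in.
by rewrite -[a in LHS]reprK; case: (repr a).
Qed.

Lemma dlim_in_map i j (ij : (i <= j)%O) (x : S i) :
  dlim_in (zs_map ij x) = dlim_in x.
Proof.
apply/dlim_inP; exists j, (lexx _), ij.
by rewrite zs_map1.
Qed.

Lemma dlim_surj2 (a b : dlim) :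
  exists i (x y : S i), a = dlim_in x /\ b = dlim_in y.
Proof.
have [i [x ->]] := dlim_surj a; have [j [y ->]] := dlim_surj b.
have [k [ik jk]] := dir_ub i j.
by exists k, (zs_map ik x), (zs_map jk y); rewrite !dlim_in_map.
Qed.

(* A map out of the direct limit is determined by its restrictions f i,
   which have to be compatible. *)
Definition dlim_desc (T : Type) (f : forall i, S i -> T) (a : dlim) : T :=
  f (tag (repr a)) (tagged (repr a)).

Lemma dlim_descE T (f : forall i, S i -> T) :
  (forall i j (ij : (i <= j)%O) x, f j (zs_map ij x) = f i x) ->
  forall i (x : S i), dlim_desc f (dlim_in x) = f i x.
Proof.
move=> fS i x; rewrite /dlim_desc.
have : dlim_in (tagged (repr (dlim_in x))) = dlim_in x.
  by rewrite -[RHS]reprK /dlim_in; case: (repr _).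
move=> /dlim_inP[k [a [b ab]]].
by rewrite -(fS _ _ a) ab fS.
Qed.

Definition dlim_ub (i j : L) : L := projT1 (cid (dir_ub i j)).

Fact dlim_ubl i j : (i <= dlim_ub i j)%O.
Proof. by rewrite /dlim_ub; case: cid => k []. Qed.

Fact dlim_ubr i j : (j <= dlim_ub i j)%O.
Proof. by rewrite /dlim_ub; case: cid => k []. Qed.

Definition dlim0 : dlim :=
  @dlim_in (projT1 (cid (let: inhabits i := dir_inhab L in ex_intro xpredT i isT))) 0.

Definition dlim_opp : dlim -> dlim := dlim_desc (fun i x => dlim_in (- x)).

Definition dlim_add (a b : dlim) : dlim :=
  dlim_desc (fun i x => dlim_desc (fun j y =>
    dlim_in (zs_map (dlim_ubl i j) x + zs_map (dlim_ubr i j) y)) b) a.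

Lemma dlim0E i : dlim0 = @dlim_in i 0.
Proof.
rewrite /dlim0; case: cid => j _ /=; apply/dlim_inP.
have [k [ik jk]] := dir_ub i j.
by exists k, jk, ik; rewrite !raddf0.
Qed.

Lemma dlim_oppE i (x : S i) : dlim_opp (dlim_in x) = dlim_in (- x).
Proof.
by rewrite /dlim_opp dlim_descE// => {x}i j ij x; rewrite -raddfN dlim_in_map.
Qed.

Lemma dlim_addE i (x y : S i) :
  dlim_add (dlim_in x) (dlim_in y) = dlim_in (x + y).
Proof.
have H i1 i2 j1 j2 k1 k2 (a1 : (i1 <= k1)%O) (a2 : (i2 <= k2)%O)
    (b1 : (j1 <= k1)%O) (b2 : (j2 <= k2)%O) (x1 : S i1) (x2 : S i2)
    (y1 : S j1) (y2 : S j2) :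
    dlim_in x1 = dlim_in x2 -> dlim_in y1 = dlim_in y2 ->
    dlim_in (zs_map a1 x1 + zs_map b1 y1) = dlim_in (zs_map a2 x2 + zs_map b2 y2).
  move=> /dlim_inP[k [c1 [c2 e]]] /dlim_inP[l [d1 [d2 f]]].
  have [m [km lm]] := dir_ub k l; have [n [k1n k2n]] := dir_ub k1 k2.
  have [o [mo no]] := dir_ub m n; apply/dlim_inP.
  have ko := le_trans km mo; have lo := le_trans lm mo.
  have k1o := le_trans k1n no; have k2o := le_trans k2n no.
  exists o, k1o, k2o; rewrite !raddfD /=; congr (_ + _).
    rewrite -(zs_mapM a1 k1o (le_trans c1 ko)) -(zs_mapM a2 k2o (le_trans c2 ko)).
    by rewrite (zs_mapM c1 ko) (zs_mapM c2 ko) e.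
  rewrite -(zs_mapM b1 k1o (le_trans d1 lo)) -(zs_mapM b2 k2o (le_trans d2 lo)).
  by rewrite (zs_mapM d1 lo) (zs_mapM d2 lo) f.
rewrite /dlim_add /dlim_desc.
have E z : dlim_in (tagged (repr (@dlim_in i z))) = dlim_in z.
  by rewrite -[RHS]reprK /dlim_in; case: (repr _).
rewrite -[x in RHS](zs_map1 (lexx i)) -[y in RHS](zs_map1 (lexx i)).
exact: H (E x) (E y).
Qed.

Fact dlim_addA : associative dlim_add.
Proof.
move=> a b c; have [i [x [y [-> ->]]]] := dlim_surj2 a b.
have [j [z ->]] := dlim_surj c; have [k [ik jk]] := dir_ub i j.
rewrite -(dlim_in_map ik x) -(dlim_in_map ik y) -(dlim_in_map jk z).
by rewrite !dlim_addE addrA.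
Qed.

Fact dlim_addC : commutative dlim_add.
Proof.
by move=> a b; have [i [x [y [-> ->]]]] := dlim_surj2 a b; rewrite !dlim_addE addrC.
Qed.

Fact dlim_add0 : left_id dlim0 dlim_add.
Proof.
by move=> a; have [i [x ->]] := dlim_surj a; rewrite (dlim0E i) dlim_addE add0r.
Qed.

Fact dlim_addN : left_inverse dlim0 dlim_opp dlim_add.
Proof.
move=> a; have [i [x ->]] := dlim_surj a.
by rewrite dlim_oppE dlim_addE addNr (dlim0E i).
Qed.

HB.instance Definition _ :=
  GRing.isZmodule.Build dlim dlim_addA dlim_addC dlim_add0 dlim_addN.

Lemma dlim_inD i : {morph @dlim_in i : x y / x + y}.
Proof. by move=> x y; rewrite -[RHS]/(dlim_add _ _) dlim_addE. Qed.

HB.instance Definition _ i :=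
  GRing.isZmodMorphism.Build (S i) dlim (@dlim_in i) (morphD_zmod (@dlim_inD i)).

Lemma dlim_descD (T : zmodType) (f : forall i, S i -> T) :
  (forall i, {morph f i : x y / x + y}) ->
  (forall i j (ij : (i <= j)%O) x, f j (zs_map ij x) = f i x) ->
  {morph dlim_desc f : a b / a + b}.
Proof.
move=> fD fS a b; have [i [x [y [-> ->]]]] := dlim_surj2 a b.
by rewrite -dlim_inD !dlim_descE// fD.
Qed.

End DirectLimit.

Section ModuleLimit.
Variables (G : grpType) (X : subgroup_family G).

Record osys (L : dirset) := OSys {
  os_obj :> L -> omod X;
  os_map : forall i j, (i <= j)%O -> ohom (os_obj i) (os_obj j);
  os_map1 : forall i (ii : (i <= i)%O), os_map ii = oid (os_obj i);
  os_mapM : forall i j k (ij : (i <= j)%O) (jk : (j <= k)%O) (ik : (i <= k)%O),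
    os_map ik = ocomp (os_map jk) (os_map ij)
}.

Variables (L : dirset) (S : osys L).

Program Definition os_at (D : orb X) : zsys L :=
  @ZSys L (fun i => S i D) (fun i j ij => os_map S ij D) _ _ _.
Next Obligation. by move=> D i j ij x y /=; rewrite raddfD. Qed.
Next Obligation. by move=> D i ii x /=; rewrite os_map1. Qed.
Next Obligation. by move=> D i j k ij jk ik x /=; rewrite (os_mapM S ij jk ik). Qed.

Definition olim_res (C D : orb X) (e : gmap C D) :
    dlim (os_at D) -> dlim (os_at C) :=
  @dlim_desc L (os_at D) _ (fun i (x : S i D) => @dlim_in L (os_at C) i (om_res e x)).

Lemma olim_resE (C D : orb X) (e : gmap C D) i (x : S i D) :
  olim_res e (@dlim_in L (os_at D) i x) = @dlim_in L (os_at C) i (om_res e x).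
Proof.
rewrite /olim_res dlim_descE// => {x}i j ij x /=.
by rewrite -oh_nat -(@dlim_in_map L (os_at C) i j ij).
Qed.

(* The direct limit of a system of modules, taken pointwise *)
Program Definition olim : omod X :=
  @OMod G X (fun D => dlim (os_at D)) olim_res _ _ _.
Next Obligation.
move=> C D e a b; have [i [x [y [-> ->]]]] := dlim_surj2 a b.
by rewrite -dlim_inD !olim_resE [om_res _ _]raddfD dlim_inD.
Qed.
Next Obligation.
by move=> D a; have [i [x ->]] := dlim_surj a; rewrite olim_resE om_res1.
Qed.
Next Obligation.
by move=> B C D f e a; have [i [x ->]] := dlim_surj a; rewrite !olim_resE om_resM.
Qed.

Program Definition olim_in (i : L) : ohom (S i) olim :=
  @OHom G X (S i) olim (fun D x => @dlim_in L (os_at D) i x) _ _.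
Next Obligation. by move=> i D x y; rewrite dlim_inD. Qed.
Next Obligation. by move=> i C D e x; rewrite /= olim_resE. Qed.

Variables (A : omod X) (P : proj_res A) (k : nat).

Program Definition ext_sys : zsys L :=
  @ZSys L (fun i => ext P k (S i)) (fun i j ij => ext_map (os_map S ij)) _ _ _.
Next Obligation. by move=> i j ij; exact: ext_mapD. Qed.
Next Obligation. by move=> i ii x /=; rewrite os_map1 ext_map_id. Qed.
Next Obligation.
by move=> i j l ij jl il x /=; rewrite (os_mapM S ij jl il) ext_map_comp.
Qed.

(* The natural map  lim Ext^k(A,S i) -> Ext^k(A,lim S) *)
Definition ext_lim_map : dlim ext_sys -> ext P k olim :=
  @dlim_desc L ext_sys _ (fun i (x : ext P k (S i)) => ext_map (olim_in i) x).

Lemma ext_lim_mapE i (x : ext P k (S i)) :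
  ext_lim_map (@dlim_in L ext_sys i x) = ext_map (olim_in i) x.
Proof.
rewrite /ext_lim_map dlim_descE// => {x}i j ij x /=.
have <- : ocomp (olim_in j) (os_map S ij) = olim_in i.
  by apply: ohomP => D y /=; exact: (@dlim_in_map L (os_at D)).
by rewrite ext_map_comp.
Qed.

Lemma ext_lim_mapD : {morph ext_lim_map : x y / x + y}.
Proof.
move=> a b; have [i [x [y [-> ->]]]] := dlim_surj2 a b.
by rewrite -dlim_inD !ext_lim_mapE ext_mapD.
Qed.

End ModuleLimit.

Arguments ext_sys {G X L} S {A} P k.
Arguments ext_lim_map {G X L} S {A} P k _.

(* Main.v *)
(* Ext is computed at cochain level: a class in the colimit of the groups
   Ext^k(A, S i) vanishes iff a representing cocycle P_k -> S i becomes a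
   coboundary at a later stage.  Comparison of projective resolutions lets us
   replace P by any other resolution Q.  (i) => (ii): if Q_k is finitely generated
   and projective, maps from Q_k to a colimit factor through some stage, and maps
   from Q_k into a stage that die in the colimit die at a later stage; so cocycles
   and coboundary equations lift to a finite stage.  (ii) => (iii) is immediate.
   (iii) => (i): resolve A by covers Q_k -> K_k of successive kernels, taking a
   finitely generated free cover whenever K_k is finitely generated.  The quotients
   of K_k by its finitely generated submodules form a directed system with colimit
   zero, and Q_k -> K_k -> K_k / 0 is a cocycle.  By (iii) it becomes a coboundary
   at some stage K_k / N; as Q_{k-1} is finitely generated by induction, the
   cochain that bounds it dies at a later stage K_k / N', so K_k = N'. *)
Require Import Defs.
From HB Require Import structures.
From mathcomp Require Import all_boot all_order all_algebra.
From mathcomp Require Import boolp classical_sets functions cardinality.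
From mathcomp Require Import freeg.

Set Implicit Arguments.
Unset Strict Implicit.
Unset Printing Implicit Defensive.

Import Order.PreorderTheory GRing.Theory.

Local Open Scope ring_scope.
Local Open Scope quotient_scope.

Local Obligation Tactic := idtac.

(** Finite lists of pairs of an object and an element will index a directed system; list membership
    and the preorder structure need equality and choice on objects. *)
HB.instance Definition _ G (X : subgroup_family G) := gen_eqMixin (orb X).
HB.instance Definition _ G (X : subgroup_family G) := gen_choiceMixin (orb X).

(** * Composition of natural transformations *)

Section HomAlgebra.
Variables (G : grpType) (X : subgroup_family G).
Implicit Types K L M N : omod X.

Lemma ocompA K L M N (h : ohom M N) (g : ohom L M) (f : ohom K L) :
  ocomp h (ocomp g f) = ocomp (ocomp h g) f.
Proof. exact: ohomP. Qed.

Lemma ocomp_idl M N (f : ohom M N) : ocomp (oid N) f = f.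
Proof. exact: ohomP. Qed.

Lemma ocomp_idr M N (f : ohom M N) : ocomp f (oid M) = f.
Proof. exact: ohomP. Qed.

Lemma ocomp0l L M N (f : ohom L M) : ocomp (0 : ohom M N) f = 0.
Proof. exact: ohomP. Qed.

Lemma ocomp0r L M N (f : ohom M N) : ocomp f (0 : ohom L M) = 0.
Proof. by apply: ohomP => D x /=; rewrite raddf0. Qed.

Lemma ocompBl L M N (g g' : ohom M N) (f : ohom L M) :
  ocomp (g - g') f = ocomp g f - ocomp g' f.
Proof. exact: ohomP. Qed.

Lemma ocompBr L M N (g : ohom M N) (f f' : ohom L M) :
  ocomp g (f - f') = ocomp g f - ocomp g f'.
Proof. by apply: ohomP => D x /=; rewrite raddfB. Qed.

End HomAlgebra.

(** * Submodules, quotients, and the system of quotients by finitely generated submodules *)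

Section Submodules.
Variables (G : grpType) (X : subgroup_family G) (M : omod X).

(** Membership is a boolean predicate so that the library quotient of an abelian group by a closed
    predicate applies at each object. *)
Record submod := Submod {
  sub_mem :> forall D : orb X, {pred M D};
  sub_closed : forall D, zmod_closed (@sub_mem D);
  sub_res : forall (C D : orb X) (f : gmap C D) x,
    x \in @sub_mem D -> om_res f x \in @sub_mem C
}.

HB.instance Definition _ (N : submod) (D : orb X) :=
  GRing.isZmodClosed.Build (M D) (@sub_mem N D) (sub_closed N D).

Section Quotient.
Variable N : submod.

Definition quot_class (D : orb X) (x : M D) :
  Quotient.quot (@sub_mem N D) := \pi x.

Lemma quot_classP D (x y : M D) :
  quot_class x = quot_class y <-> x - y \in @sub_mem N D.
Proof. by split=> [/eqmodP|xy]; [|apply/eqmodP]. Qed.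

Lemma quot_classD D : {morph @quot_class D : x y / x + y}.
Proof. by move=> x y; rewrite /quot_class !piE. Qed.

HB.instance Definition _ D :=
  GRing.isZmodMorphism.Build _ _ (@quot_class D) (morphD_zmod (@quot_classD D)).

Lemma quot_class0P D (x : M D) : quot_class x = 0 <-> x \in @sub_mem N D.
Proof. by rewrite -[0](raddf0 (@quot_class D)) quot_classP subr0. Qed.

Lemma quot_class_surj D (a : Quotient.quot (@sub_mem N D)) :
  exists x, a = quot_class x.
Proof. by exists (repr a); rewrite /quot_class reprK. Qed.

Lemma quot_reprP D (x : M D) : repr (quot_class x) - x \in @sub_mem N D.
Proof. by apply/quot_classP; rewrite /quot_class reprK. Qed.

Definition quot_res (C D : orb X) (f : gmap C D)
  (a : Quotient.quot (@sub_mem N D)) := quot_class (om_res f (repr a)).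

(** Two representatives differ by an element of [N], and [N] is stable under restriction. *)
Lemma quot_resE (C D : orb X) (f : gmap C D) (x : M D) :
  quot_res f (quot_class x) = quot_class (om_res f x).
Proof. by apply/quot_classP; rewrite -raddfB /=; apply/sub_res/quot_reprP. Qed.

Program Definition oquot : omod X :=
  @OMod G X (fun D => Quotient.quot (@sub_mem N D)) quot_res _ _ _.
Next Obligation.
move=> C D f a b; have [x ->] := quot_class_surj a.
have [y ->] := quot_class_surj b.
by rewrite -quot_classD !quot_resE raddfD quot_classD.
Qed.
Next Obligation.
by move=> D a; have [x ->] := quot_class_surj a; rewrite quot_resE om_res1.
Qed.
Next Obligation.
move=> B C D f e a; have [x ->] := quot_class_surj a.
by rewrite !quot_resE om_resM.
Qed.

Program Definition oquot_proj : ohom M oquot :=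
  @OHom G X M oquot (fun D x => quot_class x) _ _.
Next Obligation. exact: quot_classD. Qed.
Next Obligation. by move=> C D f x; rewrite [RHS]quot_resE. Qed.

End Quotient.

Section QuotientMap.
Variables (N K : submod) (NK : forall D x, x \in @sub_mem N D -> x \in @sub_mem K D).

Definition quot_map D (a : oquot N D) : oquot K D :=
  @quot_class K D (repr (a : Quotient.quot (@sub_mem N D))).

Lemma quot_mapE D (x : M D) : quot_map (quot_class N x : oquot N D) = quot_class K x.
Proof. by apply/quot_classP/NK/quot_reprP. Qed.

Program Definition oquot_map : ohom (oquot N) (oquot K) :=
  @OHom G X (oquot N) (oquot K) quot_map _ _.
Next Obligation.
move=> D a b; have [x ->] := quot_class_surj a.
have [y ->] := quot_class_surj b.
by rewrite -quot_classD !quot_mapE quot_classD.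
Qed.
Next Obligation.
move=> C D f a; have [x ->] := quot_class_surj a.
by rewrite [om_res _ _]quot_resE !quot_mapE [RHS]quot_resE.
Qed.

End QuotientMap.

Definition gens := seq {D : orb X & M D}.

(** The intersection of all submodules containing the list; minimality is then built in. *)
Definition gen_mem (s : gens) (D : orb X) : {pred M D} := fun x =>
  `[< forall N : submod, (forall p, p \in s -> tagged p \in @sub_mem N (tag p)) ->
      x \in @sub_mem N D >].

Program Definition gen (s : gens) : submod := @Submod (gen_mem s) _ _.
Next Obligation.
move=> s D; split; first by apply/asboolP => N _; rewrite rpred0.
move=> x y /asboolP sx /asboolP sy; apply/asboolP => N sN.
by rewrite rpredB ?sx ?sy.
Qed.
Next Obligation.
move=> s C D f x /asboolP sx; apply/asboolP => N sN.
by apply: sub_res; exact: sx.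
Qed.

Lemma mem_gen (s : gens) p : p \in s -> tagged p \in gen s (tag p).
Proof. by move=> ps; apply/asboolP => N; exact. Qed.

Lemma gen_min (s : gens) (N : submod) :
  (forall p, p \in s -> tagged p \in N (tag p)) ->
  forall D x, x \in gen s D -> x \in N D.
Proof. by move=> sN D x /asboolP; exact. Qed.

HB.instance Definition _ := Choice.on gens.

(** Lists are compared by what they generate. Different lists may generate the same submodule, so
    this is only a preorder. *)
Definition gens_le (s t : gens) : bool :=
  `[< forall D x, x \in gen s D -> x \in gen t D >].

Fact gens_le_refl : reflexive gens_le.
Proof. by move=> s; apply/asboolP. Qed.

Fact gens_le_trans : transitive gens_le.
Proof.
move=> t s u /asboolP st /asboolP tu; apply/asboolP => D x sx.
exact/tu/st.
Qed.

HB.instance Definition _ :=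
  Order.isPreorder.Build (Order.Disp tt tt) gens (fun x y => erefl)
    gens_le_refl gens_le_trans.


(** Kept transparent, since its elements are used as lists below. *)
Definition gens_sys_dir : dirset.
Proof.
apply: (@DirSet _ gens) => [|s t]; first by constructor; exact: [::].
exists (s ++ t); split; apply/asboolP; apply: gen_min => p sp; apply: mem_gen;
  by rewrite mem_cat sp ?orbT.
Defined.

Lemma gens_leP (s t : gens) : (s <= t)%O ->
  forall D x, x \in gen s D -> x \in gen t D.
Proof. by move=> /asboolP. Qed.

Program Definition gens_sys : osys X gens_sys_dir :=
  @OSys G X gens_sys_dir (fun s => oquot (gen s))
    (fun s t st => oquot_map (gens_leP st)) _ _.
Next Obligation.
move=> s ss; apply: ohomP => D a; have [x ->] := quot_class_surj a.
exact: quot_mapE.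
Qed.
Next Obligation.
move=> s t u st tu su; apply: ohomP => D a; have [x ->] := quot_class_surj a.
by rewrite /= !quot_mapE//; exact: gens_leP.
Qed.

(** The class of [x] modulo [gen s] dies once [x] itself joins the generators. *)
Lemma gens_sys_lim0 : ozero (olim gens_sys).
Proof.
move=> D a; have [s [b ->]] := dlim_surj a.
have [x ->] := quot_class_surj b.
pose t : gens := [:: existT _ D x].
have [u [su tu]] := dir_ub (s : gens_sys_dir) t.
rewrite -(dlim_in_map su) /= quot_mapE; last exact: gens_leP.
have -> : quot_class (gen u) x = 0; last by rewrite raddf0.
apply/quot_class0P/(gens_leP tu).
by have := @mem_gen t (existT _ D x); apply; rewrite mem_head.
Qed.

End Submodules.

Section SubmoduleMaps.
Variables (G : grpType) (X : subgroup_family G).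
Implicit Types M N : omod X.

(** Equality of homomorphisms becomes fullness of a submodule, which can be tested on generators. *)
Program Definition sub_equalizer M N (f g : ohom M N) : submod M :=
  @Submod G X M (fun D x => f D x == g D x) _ _.
Next Obligation.
move=> M N f g D; split; first by rewrite unfold_in !raddf0.
by move=> x y /eqP fx /eqP fy; rewrite unfold_in !raddfB /= fx fy.
Qed.
Next Obligation. by move=> M N f g C D e x /eqP fx; rewrite unfold_in !oh_nat fx. Qed.

Lemma sub_equalizer_full M N (f g : ohom M N) :
  (forall D x, x \in sub_equalizer f g D) -> f = g.
Proof. by move=> fg; apply: ohomP => D x; exact/eqP/fg. Qed.

Program Definition sub_preim M N (f : ohom M N) (K : submod N) : submod M :=
  @Submod G X M (fun D x => f D x \in K D) _ _.
Next Obligation.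
move=> M N f K D; split; first by rewrite unfold_in raddf0 rpred0.
by move=> x y fx fy; rewrite unfold_in raddfB rpredB.
Qed.
Next Obligation.
by move=> M N f K C D e x fx; rewrite unfold_in oh_nat; exact: sub_res.
Qed.

Program Definition sub_im M N (f : ohom M N) : submod N :=
  @Submod G X N (fun D y => `[< exists x, f D x = y >]) _ _.
Next Obligation.
move=> M N f D; split; first by apply/asboolP; exists 0; rewrite raddf0.
move=> _ _ /asboolP[x <-] /asboolP[y <-]; apply/asboolP.
by exists (x - y); rewrite raddfB.
Qed.
Next Obligation.
move=> M N f C D e _ /asboolP[x <-]; apply/asboolP.
by exists (om_res e x); rewrite oh_nat.
Qed.

End SubmoduleMaps.

(** * Representables, direct sums and the universal property of free modules *)

Section Sums.
Variables (G : grpType) (X : subgroup_family G).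

(** The Yoneda correspondence: [m] is the image of the identity of [D]. *)
Program Definition zrep_lift (D : orb X) (M : omod X) (m : M D) : ohom (zrep D) M :=
  @OHom G X (zrep D) M (fun C => flift (fun f : gmap C D => om_res f m)) _ _.
Next Obligation. by move=> D M m C x y; rewrite raddfD. Qed.
Next Obligation.
move=> D M m B C e; apply: freeg_ext => [x y|x y|f]; rewrite /= /zrep_res ?raddfD//.
by rewrite !fliftU om_resM.
Qed.

Definition zrep1 (D : orb X) : zrep D D := << gid D >>.

Lemma zrep_lift1 (D : orb X) (M : omod X) (m : M D) : zrep_lift m D (zrep1 D) = m.
Proof. by rewrite /= fliftU om_res1. Qed.

(** Every basis element [f] is the restriction of the identity of [D] along [f]. *)
Lemma zrep_full (D : orb X) (N : submod (zrep D)) :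
  zrep1 D \in N D -> forall C x, x \in N C.
Proof.
move=> N1 C x; rewrite -[x]freeg_sumE; apply: rpred_sum => f _.
have -> : << coeff f x *g f >> = << f >> *~ coeff f x :> {freeg (gmap C D) / int}.
  by rewrite freegU_mulz intz.
apply: rpredMz; have -> : << f >> = om_res f (zrep1 D) :> zrep D C.
  by rewrite /= /zrep_res fliftU; congr << _ >>; exact: gmapP.
exact: sub_res.
Qed.

Section SumMaps.
Variables (I : eqType) (M : I -> omod X).

Program Definition osum_in i : ohom (M i) (osum M) :=
  @OHom G X (M i) (osum M)
    (fun D x => @DSum _ (fun i => M i D) (dfwith (fun=> 0) x) _) _ _.
Next Obligation.
move=> i D x; apply: (sub_finite_set _ (finite_set1 i)) => j /=.
by case: dfwithP => // k _; rewrite eqxx.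
Qed.
Next Obligation.
move=> i D x y; apply: dsumP => j /=.
by case: (eqVneq i j) => [<-|ij]; rewrite ?dfwith_in// !dfwith_out// addr0.
Qed.
Next Obligation.
move=> i C D e x; apply: dsumP => j /=.
by case: (eqVneq i j) => [<-|ij]; rewrite ?dfwith_in// !dfwith_out// raddf0.
Qed.

Lemma dsum_sum D (J : Type) (r : seq J) (F : J -> osum M D) i :
  (\sum_(j <- r) F j) i = \sum_(j <- r) F j i.
Proof. by elim/big_rec2: _ => //= j x y _ <-. Qed.

(** Finiteness of the index type is expressed by a duplicate-free list of all its elements, over
    which sums are taken. *)
Variables (s : seq I) (s_uniq : uniq s) (s_all : forall i, i \in s).

Lemma osum_sumE D (x : osum M D) : x = \sum_(i <- s) osum_in i D (x i).
Proof.
apply: dsumP => i; rewrite dsum_sum (bigD1_seq i)//= dfwith_in big1 ?addr0// => j ji.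
by rewrite dfwith_out.
Qed.

Program Definition osum_lift (N : omod X) (h : forall i, ohom (M i) N) :
    ohom (osum M) N :=
  @OHom G X (osum M) N (fun D x => \sum_(i <- s) h i D (x i)) _ _.
Next Obligation.
move=> N h D x y; rewrite -big_split; apply: eq_bigr => i _ /=.
by rewrite raddfD.
Qed.
Next Obligation.
move=> N h C D e x; rewrite /= raddf_sum; apply: eq_bigr => i _ /=.
by rewrite oh_nat.
Qed.

Lemma osum_liftE (N : omod X) (h : forall i, ohom (M i) N) i D x :
  osum_lift h D (osum_in i D x) = h i D x.
Proof.
rewrite /= (bigD1_seq i)//= dfwith_in big1 ?addr0// => j ji.
by rewrite dfwith_out 1?eq_sym// raddf0.
Qed.

End SumMaps.

HB.instance Definition _ (D : gset G) := gen_eqMixin (orbits D).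

Section FiniteOrbits.
Variables (D : gset G) (XD : stab_in X D) (Dfin : finite_set [set: orbits D]%classic).

Lemma orbits_enum : {s : seq (orbits D) | uniq s /\ forall O, O \in s}.
Proof.
apply: cid; have /finite_seqP[s sT] := Dfin.
exists (undup s); split=> [|O]; first exact: undup_uniq.
by rewrite mem_undup; have : [set: orbits D]%classic O by []; rewrite sT.
Qed.

Definition zmodset1 (O : orbits D) : zmodset XD (orbit_orb XD O) :=
  osum_in (fun O => zrep (orbit_orb XD O)) O _ (zrep1 _).

(** Existence half of freeness on the elements [zmodset1]: Yoneda on each summand, then a finite sum
    over the orbits. *)
Lemma zmodset_lift (M : omod X) (m : forall O : orbits D, M (orbit_orb XD O)) :
  exists f : ohom (zmodset XD) M, forall O, f _ (zmodset1 O) = m O.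
Proof.
have [s [s_uniq s_all]] := orbits_enum.
exists (osum_lift s (fun O => zrep_lift (m O))) => O.
by rewrite osum_liftE// zrep_lift1.
Qed.

(** Uniqueness half of freeness: the elements [zmodset1] generate. *)
Lemma zmodset_full (N : submod (zmodset XD)) :
  (forall O, zmodset1 O \in N _) -> forall C x, x \in N C.
Proof.
have [s [s_uniq s_all]] := orbits_enum.
move=> N1 C x; rewrite (osum_sumE s_uniq s_all x); apply: rpred_sum => O _.
have := @zrep_full _ (sub_preim (osum_in (fun O => zrep (orbit_orb XD O)) O) N).
by apply; exact: N1.
Qed.

Lemma zmodset_ext (M : omod X) (f g : ohom (zmodset XD) M) :
  (forall O, f _ (zmodset1 O) = g _ (zmodset1 O)) -> f = g.
Proof.
by move=> fg; apply/sub_equalizer_full/zmodset_full => O; exact/eqP/fg.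
Qed.

(** Choose preimages under [e] of the images of the free generators and extend. *)
Lemma zmodset_proj : projective (zmodset XD).
Proof.
move=> M N e f esurj.
have [g gE] := zmodset_lift (fun O => projT1 (cid (esurj _ (f _ (zmodset1 O))))).
by exists g; apply: zmodset_ext => O /=; rewrite gE; case: cid.
Qed.

Lemma zmodset_fg : finitely_generated (zmodset XD).
Proof. by exists D, XD; split=> //; exists (oid _) => C y; exists y. Qed.

End FiniteOrbits.

End Sums.

(* I cannot be a finType or an ordinal type: the universe of the carrier of a
   gset lies strictly below that of finType. *)
Section Coproduct.
Variables (G : grpType) (X : subgroup_family G) (I : Type) (D : I -> orb X).

Program Definition gcoprod : gset G :=
  @GSet G {i : I & D i} (fun g p => Tagged (fun i => D i) (gact g (tagged p))) _ _.
Next Obligation. by move=> [i x]; rewrite gact1. Qed.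
Next Obligation. by move=> g h [i x]; rewrite gactM. Qed.

Definition gcoprod_in i (x : D i) : gcoprod := Tagged (fun i => D i) x.

Lemma gcoprod_in_inj i : injective (@gcoprod_in i).
Proof.
(* The second components agree up to transport along a loop at [i], which proof irrelevance makes
   trivial. *)
move=> x y xy; have := projT2_eq xy.
by rewrite (Prop_irrelevance (projT1_eq xy) erefl).
Qed.

Lemma gcoprod_stab : stab_in X gcoprod.
Proof.
move=> [i x]; have := orb_stab x.
congr (Defs.family_mem X); apply: funext => g; apply: propext; split=> [gx|].
  by rewrite /gstab /= gx.
by move=> /gcoprod_in_inj.
Qed.

Lemma gcoprod_orbit i (x : D i) :
  (fun p => exists g, gact g (gcoprod_in x) = p) = (fun p : gcoprod => tag p = i).
Proof.
apply: funext => -[j y]; apply: propext; split=> [[g]|/= ji].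
  by move=> /(congr1 tag).
subst j; have [g <-] := (orb_trans (D i)).2 x y.
by exists g.
Qed.

Fact component_proof i :
  exists x : gcoprod, (fun p : gcoprod => tag p = i) = fun p => exists g, gact g x = p.
Proof.
have [[x] _] := orb_trans (D i).
by exists (gcoprod_in x); rewrite gcoprod_orbit.
Qed.

Definition component i : orbits gcoprod := exist _ _ (component_proof i).

Lemma componentP (O : orbits gcoprod) : exists i, O = component i.
Proof.
case: O => O OP; have [[i x] Ox] := OP; exists i; apply: eq_exist => /=.
by rewrite Ox [LHS]gcoprod_orbit.
Qed.

Lemma gcoprod_fin :
  finite_set [set: I]%classic -> finite_set [set: orbits gcoprod]%classic.
Proof.
move=> /(finite_image component); apply: sub_finite_set => O _ /=.
by have [i ->] := componentP O; exists i.
Qed.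

Program Definition component_in i : gmap (D i) (orbit_set (component i)) :=
  @GMap G (D i) (orbit_set (component i)) (fun x => exist _ (gcoprod_in x) (erefl i)) _.
Next Obligation. by move=> i g x; apply: eq_exist. Qed.

(** An inverse of [component_in], obtained by choice; it is equivariant because [gcoprod_in] is
    injective. *)
Lemma component_inK i : exists f : gmap (orbit_set (component i)) (D i),
  forall q, gcoprod_in (f q) = sval q.
Proof.
have pre (q : orbit_set (component i)) : exists x : D i, gcoprod_in x = sval q.
  by case: q => -[j x] /= ji; subst j; exists x.
have [f fP] := choice pre.
have fA g q : f (gact g q) = gact g (f q).
  apply: gcoprod_in_inj; rewrite fP /= -fP.
  by [].
by exists (GMap fA).
Qed.

End Coproduct.

(** * Finite generation by $G$-sets versus finite lists of generators *)

Section FinitelyGenerated.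
Variables (G : grpType) (X : subgroup_family G).

Lemma fg_gens (M : omod X) : finitely_generated M ->
  exists s : gens M, forall D x, x \in gen s D.
Proof.
move=> [D [XD [Dfin [e esurj]]]]; have [r [_ r_all]] := orbits_enum Dfin.
pose t O : {D : orb X & M D} := Tagged (fun D => M D) (e _ (zmodset1 XD O)).
pose s : gens M := map t r.
exists s => C x; have [y <-] := esurj C x.
have := @zmodset_full _ _ D XD Dfin (sub_preim e (gen s)); apply=> O.
by apply: (@mem_gen _ _ _ s (t O)); apply: map_f.
Qed.

(** Form the coproduct of the objects that carry the listed elements, one copy per list position,
    and send the free generator of each component to the corresponding element. *)
Lemma gens_fg (M : omod X) (s : gens M) :
  (forall D x, x \in gen s D) -> finitely_generated M.
Proof.
move=> s_full; pose I : Type := {i : nat | (i < size s)%N}.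
pose a (k : I) := let: exist i i_lt := k in tnth (in_tuple s) (Ordinal i_lt).
pose D (i : I) := tag (a i).
have XD := @gcoprod_stab _ _ I D.
have Dfin : finite_set [set: orbits (gcoprod D)]%classic.
  apply: gcoprod_fin.
  pose f (i : 'I_(size s)) : I := exist _ (val i) (ltn_ord i).
  have := finite_image f (@finite_finset _ setT).
  apply: sub_finite_set => -[i i_lt] _ /=.
  by exists (Ordinal i_lt) => //; apply: eq_exist.
(* An orbit [O] is only provably equal to a component, so its image is characterised by restrictions
   along compatible maps, which avoids transport between types. *)
have mEx (O : orbits (gcoprod D)) : exists m : M (orbit_orb XD O),
    forall i (f : gmap (D i) (orbit_orb XD O)),
      (forall x, sval (f x) = gcoprod_in x) -> om_res f m = tagged (a i).
  have [j ->] := componentP O; have [f' f'P] := component_inK D j.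
  exists (om_res (f' : gmap (orbit_orb XD (component D j)) _) (tagged (a j) : M (D j))).
  move=> i f fP; have [[x0] _] := orb_trans (D i).
  have ij : j = i by have := f'P (f x0); rewrite fP => /(congr1 tag).
  subst j; rewrite -om_resM -[RHS]om_res1; congr om_res.
  by apply: gmapP => x /=; apply: gcoprod_in_inj; rewrite f'P fP.
pose m O := projT1 (cid (mEx O)).
have [e eE] := zmodset_lift Dfin m.
exists (gcoprod D), XD; split=> //; exists e => C x; apply/asboolP.
apply: (gen_min (N := sub_im e) _ (s_full C x)) => p.
move=> /(@tnthP _ _ (in_tuple s))[[i i_lt] ->].
apply/asboolP; pose k : I := exist _ i i_lt.
pose f : gmap (D k) (orbit_orb XD (component D k)) := component_in D k.
exists (@om_res _ _ (zmodset XD) _ _ f (zmodset1 XD (component D k))).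
by rewrite oh_nat eE; rewrite /m; case: cid => y yP; apply: (yP k f).
Qed.

End FinitelyGenerated.

(** * Maps from finitely generated modules into direct limits *)

Section Limits.
Variable L : dirset.

(** Serves to replace one stage per generator by a common stage for all generators. *)
Lemma dir_ub_seq (I : eqType) (s : seq I) (Q : I -> L -> Prop) (i : L) :
  (forall a j k, (j <= k)%O -> Q a j -> Q a k) ->
  (forall a, a \in s -> exists j, Q a j) ->
  exists j, (i <= j)%O /\ forall a, a \in s -> Q a j.
Proof.
move=> Q_mono; elim: s => [|a s IHs] Qs; first by exists i.
have [|j [ij sj]] := IHs; first by move=> b bs; apply: Qs; rewrite inE bs orbT.
have [l Ql] := Qs a (mem_head a s); have [k [jk lk]] := dir_ub j l.
exists k; split=> [|b]; first exact: le_trans jk.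
rewrite inE => /predU1P[->|/sj Qb]; first exact: Q_mono Ql.
exact: Q_mono Qb.
Qed.

Lemma dlim_in_eq0 (S : zsys L) i (x : S i) :
  dlim_in x = 0 <-> exists j (ij : (i <= j)%O), zs_map ij x = 0.
Proof.
split=> [|[j [ij x0]]]; last by rewrite -(dlim_in_map ij) x0 raddf0.
rewrite -[0](raddf0 (@dlim_in L S i)) => /dlim_inP[j [ij [ij' e]]].
by exists j, ij; rewrite e raddf0.
Qed.

Variables (G : grpType) (X : subgroup_family G) (S : osys X L).

Lemma os_map_comp (F : omod X) i j k (ij : (i <= j)%O) (jk : (j <= k)%O)
    (ik : (i <= k)%O) (f : ohom F (S i)) :
  ocomp (os_map S ik) f = ocomp (os_map S jk) (ocomp (os_map S ij) f).
Proof. by rewrite (os_mapM S ij jk ik) ocompA. Qed.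

Lemma olim_in_map i j (ij : (i <= j)%O) :
  ocomp (olim_in S j) (os_map S ij) = olim_in S i.
Proof. by apply: ohomP => D x /=; apply: (@dlim_in_map L (os_at S D)). Qed.

(** Each of finitely many generators of [F] dies at some stage, so [f] vanishes on all of them,
    hence everywhere, at a common later stage. *)
Lemma fg_olim_eq0 (F : omod X) i (f : ohom F (S i)) : finitely_generated F ->
  ocomp (olim_in S i) f = 0 -> exists j (ij : (i <= j)%O), ocomp (os_map S ij) f = 0.
Proof.
move=> /fg_gens[s s_full] f0.
pose Q (p : {D : orb X & F D}) j :=
  exists ij : (i <= j)%O, os_map S ij _ (f _ (tagged p)) = 0.
have [p j k jk [ij pj]|p _|j [ij sj]] := @dir_ub_seq _ s Q i.
- exists (le_trans ij jk); have := os_map_comp ij jk (le_trans ij jk) f.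
  by move=> /(congr1 (fun h => oh_fun h _ (tagged p))) /= ->; rewrite pj raddf0.
- apply/(@dlim_in_eq0 (os_at S (tag p))).
  exact: (congr1 (fun h => oh_fun h _ (tagged p)) f0).
exists j, ij; apply: sub_equalizer_full => D x.
apply: (gen_min (N := sub_equalizer (ocomp (os_map S ij) f) 0) _ (s_full D x)) => p ps.
by have [ij' pj] := sj p ps; apply/eqP; rewrite -[RHS]pj (bool_irrelevance ij' ij).
Qed.

(** Projectivity makes [F] a retract, via [t] and [e], of a free module on finitely many orbits.
    From the latter, a map to the limit is lifted on generators at a common stage. *)
Lemma fg_olim_surj (F : omod X) (f : ohom F (olim S)) : finitely_generated F ->
  projective F -> exists i (g : ohom F (S i)), ocomp (olim_in S i) g = f.
Proof.
move=> [D [XD [Dfin [e esurj]]]] F_proj.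
have [t tK] := F_proj _ _ e (oid F) esurj.
have [s [_ s_all]] := orbits_enum Dfin.
pose Q (O : orbits D) i := exists x : S i (orbit_orb XD O),
  olim_in S i _ x = f _ (e _ (zmodset1 XD O)).
have [i0] := dir_inhab L.
have [p j k jk [x xE]|O _|i [_ si]] := @dir_ub_seq _ s Q i0.
- exists (os_map S jk _ x); rewrite -xE.
  exact: (@dlim_in_map L (os_at S _)).
- have [i [x xE]] := dlim_surj (f _ (e _ (zmodset1 XD O))).
  by exists i, x; rewrite xE.
pose m O := projT1 (cid (si O (s_all O))).
have [g gE] := zmodset_lift Dfin m.
exists i, (ocomp g t).
have -> : f = ocomp (ocomp f e) t.
  by rewrite -ocompA tK ocomp_idr.
rewrite ocompA; congr ocomp.
apply: (zmodset_ext Dfin) => O /=; rewrite gE /m; case: cid => x /= xE.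
exact: xE.
Qed.

End Limits.

(** Builds chain maps and homotopies degree by degree; the invariant [J] is what makes the next
    degree solvable. *)
Lemma dependent_choice (T : nat -> Type) (J : forall k, T k -> Prop)
    (R : forall k, T k -> T k.+1 -> Prop) (t0 : T 0) :
  J 0 t0 -> (forall k t, J k t -> exists2 t', J k.+1 t' & R k t t') ->
  exists t : forall k, T k, t 0 = t0 /\ forall k, R k (t k) (t k.+1).
Proof.
move=> J0 step.
pose next k (t : {t | J k t}) : {t | J k.+1 t} :=
  let c := cid2 (step k (sval t) (svalP t)) in exist _ (s2val c) (s2valP c).
pose fix u k : {t | J k t} := if k is j.+1 then next j (u j) else exist _ t0 J0.
exists (fun k => sval (u k)); split=> // k /=.
exact: (s2valP' (cid2 (step k (sval (u k)) (svalP (u k))))).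
Qed.

(** * Lifting through projectives and comparison of resolutions *)

Section Lifting.
Variables (G : grpType) (X : subgroup_family G).

Program Definition oker_lift (L M N : omod X) (g : ohom M N) (f : ohom L M)
    (gf : ocomp g f = 0) : ohom L (oker g) :=
  @OHom G X L (oker g) (fun D x => @KerElt G X M N g D (f D x) _) _ _.
Next Obligation.
by move=> L M N g f gf D x; apply/eqP; exact: (congr1 (fun h => oh_fun h D x) gf).
Qed.
Next Obligation. by move=> L M N g f gf D x y; apply: val_inj; rewrite /= raddfD. Qed.
Next Obligation. by move=> L M N g f gf C D e x; apply: val_inj; rewrite /= oh_nat. Qed.

Lemma oker_liftK (L M N : omod X) (g : ohom M N) (f : ohom L M) (gf : ocomp g f = 0) :
  ocomp (oker_in g) (oker_lift gf) = f.
Proof. exact: ohomP. Qed.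

Lemma oexact_comp0 (L M N : omod X) (f : ohom L M) (g : ohom M N) :
  oexact f g -> ocomp g f = 0.
Proof. by move=> fg; apply: ohomP => D x; apply/fg; exists x. Qed.

(** [h] lands in the kernel of [g], onto which [f] surjects by exactness. *)
Lemma proj_lift (P L M N : omod X) (f : ohom L M) (g : ohom M N) (h : ohom P M) :
  projective P -> oexact f g -> ocomp g h = 0 -> exists h', ocomp f h' = h.
Proof.
move=> P_proj fg gh.
have [|h' h'E] := P_proj _ _ (oker_lift (oexact_comp0 fg)) (oker_lift gh).
  move=> D [y y0]; have [x xy] := (fg D y).1 (eqP y0).
  by exists x; apply: val_inj.
exists h'; rewrite -(oker_liftK gh) -h'E ocompA.
by rewrite oker_liftK.
Qed.

Variable A : omod X.

Definition chain_map (P Q : proj_res A) (phi : forall k, ohom (P k) (Q k)) : Prop :=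
  ocomp (pr_aug Q) (phi 0) = pr_aug P /\
  forall k, ocomp (pr_d Q k) (phi k.+1) = ocomp (phi k) (pr_d P k).

Lemma pr_d0 (P : proj_res A) : ocomp (pr_aug P) (pr_d P 0) = 0.
Proof. exact/oexact_comp0/pr_exact0. Qed.

Lemma pr_dd (P : proj_res A) k : ocomp (pr_d P k) (pr_d P k.+1) = 0.
Proof. exact/oexact_comp0/pr_exact. Qed.

Lemma chain_map_ex (P Q : proj_res A) : exists phi, @chain_map P Q phi.
Proof.
have [f0 f0E] := pr_proj (pr_aug P) (@pr_surj _ _ _ Q).
(* The condition for lifting once more: the differential of [Q], or its augmentation in degree 0,
   kills [f] composed with the incoming differential of [P]. *)
pose J k : ohom (P k) (Q k) -> Prop :=
  match k with
  | 0 => fun f => ocomp (ocomp (pr_aug Q) f) (pr_d P 0) = 0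
  | j.+1 => fun f => ocomp (ocomp (pr_d Q j) f) (pr_d P j.+1) = 0
  end.
pose R k f f' := ocomp (pr_d Q k) f' = ocomp f (pr_d P k).
have [||phi [phi0 phiE]] := @dependent_choice _ J R f0.
- by rewrite /J /= f0E pr_d0.
- move=> k f Jf; have [f' f'E] : exists f', R k f f'.
    case: k f Jf => [|k] f; rewrite /J -ocompA => Jf.
      exact: (proj_lift (@pr_proj _ _ _ P 1) (@pr_exact0 _ _ _ Q)).
    exact: (proj_lift (@pr_proj _ _ _ P k.+2) (@pr_exact _ _ _ Q k)).
  exists f' => //; rewrite /J [ocomp _ f']f'E -ocompA pr_dd.
  exact: ocomp0r.
by exists phi; split=> //; rewrite phi0.
Qed.

Lemma chain_homotopy (P Q : proj_res A) phi psi :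
  @chain_map P Q phi -> @chain_map P Q psi ->
  exists s : forall k, ohom (P k) (Q k.+1),
    ocomp (pr_d Q 0) (s 0) = phi 0 - psi 0 /\
    forall k, ocomp (pr_d Q k.+1) (s k.+1) = phi k.+1 - psi k.+1 - ocomp (s k) (pr_d P k).
Proof.
move=> [phi0 phiS] [psi0 psiS].
have [|s0 s0E] := proj_lift (h := phi 0 - psi 0)
    (@pr_proj _ _ _ P 0) (@pr_exact0 _ _ _ Q).
  by rewrite ocompBr phi0 psi0 subrr.
(* The right-hand side of the next homotopy equation must be a cycle; exactness of [Q] then solves
   it. *)
pose J k (s : ohom (P k) (Q k.+1)) :=
  ocomp (pr_d Q k) (phi k.+1 - psi k.+1 - ocomp s (pr_d P k)) = 0.
pose R k s s' := ocomp (pr_d Q k.+1) s' = phi k.+1 - psi k.+1 - ocomp s (pr_d P k).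
have [||s [s0' sE]] := @dependent_choice _ J R s0.
- by rewrite /J 2!ocompBr !phiS !psiS ocompA s0E ocompBl subrr.
- move=> k s Js.
  have [s' s'E] := proj_lift (@pr_proj _ _ _ P k.+1) (@pr_exact _ _ _ Q k) Js.
  exists s' => //; rewrite /J 2!ocompBr !phiS !psiS ocompA s'E.
  by rewrite !ocompBl -(ocompA s) pr_dd ocomp0r subr0 subrr.
by exists s; rewrite s0'.
Qed.

(** The condition [coboundary] on bare homomorphisms instead of the subtype of cocycles, so that
    cochains can be composed freely. *)
Definition is_coboundary (P : proj_res A) k : forall M, ohom (P k) M -> Prop :=
  match k with
  | 0 => fun M f => f = 0
  | j.+1 => fun M f => exists g : ohom (P j) M, ocomp g (pr_d P j) = f
  end.

Lemma coboundaryP (P : proj_res A) k M (z : cocycles P k M) :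
  z \in @coboundary _ _ _ P k M <-> is_coboundary (cocycle_val z).
Proof.
case: k z => [|k] z; last by split=> /asboolP.
by split=> [/eqP -> //|z0]; apply/eqP; apply: val_inj.
Qed.

Lemma cocycleE (P : proj_res A) k M (f : ohom (P k) M) :
  f \in @cocycle _ _ _ P k M <-> ocomp f (pr_d P k) = 0.
Proof. by split=> /eqP. Qed.

Lemma is_coboundary0 (P : proj_res A) k M : is_coboundary (0 : ohom (P k) M).
Proof. by case: k => //= k; exists 0; rewrite ocomp0l. Qed.

Lemma is_coboundaryB (P : proj_res A) k M (f g : ohom (P k) M) :
  is_coboundary f -> is_coboundary g -> is_coboundary (f - g).
Proof.
case: k f g => [|k] f g /=; first by move=> -> ->; rewrite subrr.
by move=> [u <-] [v <-]; exists (u - v); rewrite ocompBl.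
Qed.

Lemma cocycle_pull (P Q : proj_res A) phi k M (f : ohom (Q k) M) :
  @chain_map P Q phi -> ocomp f (pr_d Q k) = 0 ->
  ocomp (ocomp f (phi k)) (pr_d P k) = 0.
Proof. by move=> [_ phiS] f0; rewrite -ocompA -phiS ocompA f0 ocomp0l. Qed.

Lemma coboundary_pull (P Q : proj_res A) phi k M (f : ohom (Q k) M) :
  @chain_map P Q phi -> is_coboundary f -> is_coboundary (ocomp f (phi k)).
Proof.
case: k f => [|k] f [_ phiS] /=; first by move=> ->; rewrite ocomp0l.
by move=> [g <-]; exists (ocomp g (phi k)); rewrite -!ocompA phiS.
Qed.

(** With $\phi-\psi=ds+sd$ and $fd=0$, the difference is $(fs)d$; in degree 0 the term $sd$ is
    absent and the difference is zero. *)
Lemma cocycle_homotopic (P Q : proj_res A) phi psi k M (f : ohom (Q k) M) :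
  @chain_map P Q phi -> @chain_map P Q psi -> ocomp f (pr_d Q k) = 0 ->
  is_coboundary (ocomp f (phi k) - ocomp f (psi k)).
Proof.
move=> phiP psiP; have [s [s0 sS]] := chain_homotopy phiP psiP.
rewrite -ocompBr; case: k f => [|k] f /= f0; first by rewrite -s0 ocompA f0 ocomp0l.
exists (ocomp f (s k)); rewrite -ocompA; apply/esym/eqP; rewrite -subr_eq0.
by rewrite -ocompBr -sS ocompA f0 ocomp0l.
Qed.

Lemma chain_map_id (P : proj_res A) : @chain_map P P (fun k => oid (P k)).
Proof. by split=> [|k]; rewrite ?ocomp_idl ocomp_idr. Qed.

Lemma chain_map_comp (P Q R : proj_res A) psi phi :
  @chain_map Q R psi -> @chain_map P Q phi ->
  @chain_map P R (fun k => ocomp (psi k) (phi k)).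
Proof.
move=> [psi0 psiS] [phi0 phiS]; split=> [|k]; first by rewrite ocompA psi0.
by rewrite ocompA psiS -!ocompA phiS.
Qed.

(** The round trip through [Q] is homotopic to the identity, so it changes [f] only by a
    coboundary. *)
Lemma coboundary_pull_pull (P Q : proj_res A) phi psi k M (f : ohom (P k) M) :
  @chain_map P Q phi -> @chain_map Q P psi -> ocomp f (pr_d P k) = 0 ->
  is_coboundary (ocomp f (psi k)) -> is_coboundary f.
Proof.
move=> phiP psiP f0 /(coboundary_pull phiP) fpp.
have := cocycle_homotopic (chain_map_comp psiP phiP) (chain_map_id P) f0.
rewrite ocomp_idr ocompA => /(is_coboundaryB fpp).
by rewrite opprB addrC subrK.
Qed.

End Lifting.

Lemma ltn_extW k n : ltn_ext k n -> leq_ext k n.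
Proof. by case: n => //= n /ltnW. Qed.

Lemma ltn_extS k n : ltn_ext k n = leq_ext k.+1 n.
Proof. by case: n. Qed.

Lemma leq_ext_trans k l n : (k <= l)%N -> leq_ext l n -> leq_ext k n.
Proof. by case: n => //= n; exact: leq_trans. Qed.

Lemma leq_ext_eqVlt k n : leq_ext k n -> n = Some k \/ ltn_ext k n.
Proof.
case: n => [n|] /=; last by right.
by rewrite leq_eqVlt => /predU1P[->|]; [left|right].
Qed.

(** * Ext and direct limits *)

Section ExtLimit.
Variables (G : grpType) (X : subgroup_family G) (A : omod X).
Implicit Types (P Q : proj_res A) (L : dirset).

Lemma ext_class_eq0 P k M (z : cocycles P k M) :
  ext_class z = 0 <-> is_coboundary (cocycle_val z).
Proof.
rewrite -coboundaryP -[z in z \in _]subr0 -ext_classP.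
suff -> : ext_class (0 : cocycles P k M) = 0 by [].
by apply: (addIr (ext_class 0)); rewrite -ext_classD !add0r.
Qed.

Lemma ext_sys_eq0 P k L (S : osys X L) i (z : cocycles P k (S i)) :
  @dlim_in L (ext_sys S P k) i (ext_class z) = 0 <->
  exists j (ij : (i <= j)%O), is_coboundary (ocomp (os_map S ij) (cocycle_val z)).
Proof.
rewrite dlim_in_eq0; split=> -[j [ij]].
  by rewrite /= ext_mapE => /ext_class_eq0; exists j, ij.
by move=> z0; exists j, ij; rewrite /= ext_mapE; exact/ext_class_eq0.
Qed.

Lemma ozero_ohom (M N : omod X) (f : ohom M N) : ozero N -> f = 0.
Proof. by move=> N0; apply: ohomP => D x; rewrite [LHS]N0. Qed.

(** In positive degree the bounding cochain [g] comes from some stage; the defect [h] of its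
    equation vanishes in the limit, hence at a later stage. *)
Lemma olim_coboundary P k L (S : osys X L) i (f : ohom (P k) (S i)) :
  (forall l, (l <= k)%N -> finitely_generated (P l)) ->
  is_coboundary (ocomp (olim_in S i) f) ->
  exists j (ij : (i <= j)%O), is_coboundary (ocomp (os_map S ij) f).
Proof.
case: k f => [|k] f Pfg /=; first exact/fg_olim_eq0/Pfg.
move=> [g gE].
have [i' [g' g'E]] := fg_olim_surj g (Pfg k (leqnSn k)) (@pr_proj _ _ _ P k).
have [m [im im']] := dir_ub i i'.
pose h := ocomp (os_map S im) f - ocomp (ocomp (os_map S im') g') (pr_d P k).
have [|j [mj hj]] := fg_olim_eq0 (f := h) (Pfg k.+1 (leqnn _)).
  by rewrite ocompBr !ocompA !olim_in_map g'E gE subrr.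
exists j, (le_trans im mj), (ocomp (os_map S mj) (ocomp (os_map S im') g')).
rewrite (os_map_comp im mj); apply/esym/eqP; rewrite -subr_eq0 -ocompA -ocompBr.
exact/eqP.
Qed.

Section FiniteType.
Variables (n : option nat) (P Q : proj_res A).
Hypothesis Qfg : forall i, leq_ext i n -> finitely_generated (Q i).
Variables (L : dirset) (S : osys X L) (k : nat).

Lemma ext_lim_map_inj : leq_ext k n -> injective (ext_lim_map S P k).
Proof.
move=> kn; suff ker0 x : ext_lim_map S P k x = 0 -> x = 0.
  move=> x y xy; apply/eqP; rewrite -subr_eq0; apply/eqP/ker0.
  apply: (addIr (ext_lim_map S P k y)).
  by rewrite -ext_lim_mapD subrK xy add0r.
have [i [a ->]] := dlim_surj x; have [z ->] := ext_class_surj a.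
rewrite ext_lim_mapE ext_mapE => /ext_class_eq0 /= z0.
have [phi phiP] := chain_map_ex P Q; have [psi psiP] := chain_map_ex Q P.
have zd := (cocycleE _).1 (cocycleP z).
(* The argument runs on [Q], where the finiteness is; the result returns to [P] by
   [coboundary_pull_pull]. *)
have [l lk||j [ij zj]] := @olim_coboundary Q k L S i (ocomp z (psi k)).
- by apply: Qfg; exact: leq_ext_trans kn.
- by rewrite ocompA; exact: (coboundary_pull psiP).
apply/ext_sys_eq0; exists j, ij.
apply: (coboundary_pull_pull phiP psiP); first by rewrite -ocompA zd ocomp0r.
by rewrite -ocompA.
Qed.

Lemma ext_lim_map_surj : ltn_ext k n -> forall x, exists y, ext_lim_map S P k y = x.
Proof.
move=> kn x; have [z ->] := ext_class_surj x.
have [phi phiP] := chain_map_ex P Q; have [psi psiP] := chain_map_ex Q P.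
have zd := (cocycleE _).1 (cocycleP z).
have [i [g gE]] := fg_olim_surj (ocomp z (psi k)) (Qfg (ltn_extW kn))
    (@pr_proj _ _ _ Q k).
(* The lift [g] is only a cochain. Its coboundary dies at stage [j] because [Q k.+1] is finitely
   generated, which is where [k] must be strictly below [n]. *)
have [||j [ij gj]] := @fg_olim_eq0 L G X S (Q k.+1) i (ocomp g (pr_d Q k)).
- by apply: Qfg; rewrite -ltn_extS.
- by rewrite ocompA gE (cocycle_pull psiP zd).
pose f := ocomp (ocomp (os_map S ij) g) (phi k).
have fd : f \in @cocycle _ _ _ P k (S j).
  by apply/cocycleE/(cocycle_pull phiP); rewrite -ocompA.
exists (@dlim_in L (ext_sys S P k) j (ext_class (Cocycle fd))).
rewrite ext_lim_mapE ext_mapE; apply/ext_classP/coboundaryP => /=.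
have -> : ocomp (olim_in S j) f = ocomp z (ocomp (psi k) (phi k)).
  by rewrite /f !ocompA olim_in_map gE.
rewrite -[X in _ - X]ocomp_idr.
exact: (cocycle_homotopic (chain_map_comp psiP phiP) (chain_map_id P) zd).
Qed.

End FiniteType.

(** Carries vanishing of the limit of Ext, computed from [P], over to cocycles on any other
    resolution. *)
Lemma ext_vanish_cocycle P Q L (S : osys X L) k :
  (forall x : dlim (ext_sys S P k), x = 0) ->
  forall i (f : ohom (Q k) (S i)), ocomp f (pr_d Q k) = 0 ->
  exists j (ij : (i <= j)%O), is_coboundary (ocomp (os_map S ij) f).
Proof.
move=> ext0 i f fd.
have [phi phiP] := chain_map_ex P Q; have [psi psiP] := chain_map_ex Q P.
have fphi := (cocycleE _).2 (cocycle_pull phiP fd).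
have [j [ij fj]] := (ext_sys_eq0 (Cocycle fphi)).1 (ext0 _).
exists j, ij; apply: (coboundary_pull_pull psiP phiP); last by rewrite -ocompA.
by rewrite -ocompA fd ocomp0r.
Qed.

End ExtLimit.

(** * A resolution that is finitely generated wherever possible *)

Section CoverResolution.
Variables (G : grpType) (X : subgroup_family G).

(** Excluded middle decides whether [M] is finitely generated, so one resolution serves for every
    [n]. *)
Lemma proj_cover_ex (M : omod X) : exists c : {P : omod X & ohom P M},
  [/\ projective (tag c), osurj (tagged c)
    & finitely_generated M -> finitely_generated (tag c)].
Proof.
have [[D [XD [Dfin [e esurj]]]]|nfg] := pselect (finitely_generated M).
  exists (existT _ (zmodset XD) e); split=> //; first exact: zmodset_proj.
  by move=> _; exact: zmodset_fg.
exists (existT _ (free_cover M) (free_cover_map M)).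
by split=> //; [exact: free_cover_proj|exact: free_cover_surj].
Qed.

Definition proj_cover M := projT1 (cid (proj_cover_ex M)).

Lemma proj_coverP M : [/\ projective (tag (proj_cover M)), osurj (tagged (proj_cover M))
  & finitely_generated M -> finitely_generated (tag (proj_cover M))].
Proof. by rewrite /proj_cover; case: cid. Qed.

Variable A : omod X.

Fixpoint cover_syzygy k : omod X :=
  if k is j.+1 then oker (tagged (proj_cover (cover_syzygy j))) else A.

Definition cover_obj k := tag (proj_cover (cover_syzygy k)).

Definition cover_map k : ohom (cover_obj k) (cover_syzygy k) :=
  tagged (proj_cover (cover_syzygy k)).

Definition cover_d k : ohom (cover_obj k.+1) (cover_obj k) :=
  ocomp (oker_in (cover_map k)) (cover_map k.+1).

Lemma cover_surj k : osurj (cover_map k).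
Proof. by have [] := proj_coverP (cover_syzygy k). Qed.

Lemma cover_exact k : oexact (cover_d k) (cover_map k).
Proof.
move=> D y; split=> [/eqP y0|[x <-]].
  have [x xy] := @cover_surj k.+1 D (KerElt y0).
  by exists x; rewrite [LHS](congr1 (@ker_val _ _ _ _ _ _) xy).
exact/eqP/(ker_valP (cover_map k.+1 D x)).
Qed.

Definition cover_res : proj_res A.
Proof.
apply: (@ProjRes G X A cover_obj cover_d (cover_map 0)).
- by move=> k; have [] := proj_coverP (cover_syzygy k).
- exact: (@cover_surj 0).
- exact: (@cover_exact 0).
(* [cover_d k] is [cover_map k.+1] followed by an injection, so both have the same kernel. *)
move=> k D y; rewrite -cover_exact; split=> [y0|y0]; first exact: val_inj.
by rewrite [LHS](congr1 (@ker_val _ _ _ _ _ _) y0).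
Defined.

Lemma cover_res_fg k :
  finitely_generated (cover_syzygy k) -> finitely_generated (cover_res k).
Proof. by have [] := proj_coverP (cover_syzygy k). Qed.

End CoverResolution.

Lemma oquot_map_proj (G : grpType) (X : subgroup_family G) (M : omod X)
    (s t : gens_sys_dir M) (st : (s <= t)%O) :
  ocomp (os_map (gens_sys M) st) (oquot_proj (gen s)) = oquot_proj (gen t).
Proof. by apply: ohomP => D x /=; rewrite quot_mapE//; exact: gens_leP. Qed.

(** The image of [f], which is all of [N], lies in the submodule generated by [s]. *)
Lemma osurj_gens_fg (G : grpType) (X : subgroup_family G) (M N : omod X)
    (f : ohom M N) (s : gens N) :
  osurj f -> ocomp (oquot_proj (gen s)) f = 0 -> finitely_generated N.
Proof.
move=> fsurj sf0; apply: (@gens_fg _ _ _ s) => D y; have [x <-] := fsurj D y.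
by apply/quot_class0P; exact: (congr1 (fun h => oh_fun h D x) sf0).
Qed.

Lemma cover_syzygy_fg (G : grpType) (X : subgroup_family G) (A : omod X)
    (P : proj_res A) (n : option nat) :
  (forall (L : dirset) (S : osys X L), ozero (olim S) ->
    forall k, leq_ext k n -> forall x : dlim (ext_sys S P k), x = 0) ->
  forall k, leq_ext k n -> finitely_generated (cover_syzygy A k).
Proof.
move=> ext0; elim=> [|k IHk] kn.
all: set K := cover_syzygy A _; have S0 := @gens_sys_lim0 _ _ K.
(* The empty list generates the zero submodule, so this is the cover followed by the quotient by
   zero. *)
all: pose f := ocomp (oquot_proj (gen [::])) (cover_map A _ : ohom _ K).
all: have fd : ocomp f (cover_d A _) = 0
  by rewrite -ocompA (oexact_comp0 (@cover_exact _ _ A _)) ocomp0r.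
  (* In degree 0 the only coboundary is zero, so the cover already vanishes modulo the list [j]. *)
  have [j [ij fj]] := @ext_vanish_cocycle _ _ _ P (cover_res A) _ (gens_sys K) 0
    (ext0 _ _ S0 0 kn) [::] f fd.
  apply: (@osurj_gens_fg _ _ _ _ (cover_map A 0) j (@cover_surj _ _ A 0)).
  by rewrite -fj ocompA oquot_map_proj.
have [j [ij [g gE]]] := @ext_vanish_cocycle _ _ _ P (cover_res A) _ (gens_sys K) k.+1
    (ext0 _ _ S0 k.+1 kn) [::] f fd.
(* The bounding cochain [g] starts from a module that is finitely generated by induction and maps
   into a system with limit zero, so it dies at some [l]. *)
have [|l [jl gl]] := fg_olim_eq0 (f := g)
    (cover_res_fg (IHk (leq_ext_trans (leqnSn k) kn))).
  exact: ozero_ohom.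
apply: (@osurj_gens_fg _ _ _ _ (cover_map A k.+1) l (@cover_surj _ _ A k.+1)).
have il := le_trans ij jl.
rewrite -(oquot_map_proj il) -ocompA -/f (os_map_comp ij jl) -gE ocompA gl.
exact: ocomp0l.
Qed.

Lemma inj_surj_bijective (T U : Type) (f : T -> U) :
  injective f -> (forall y, exists x, f x = y) -> bijective f.
Proof.
move=> f_inj f_surj; have [g gK] := choice f_surj.
by exists g => // x; apply: f_inj; rewrite gK.
Qed.

(** [P] is an arbitrary resolution that computes Ext; the finiteness condition may be witnessed by a
    different one. *)
Theorem theorem5p3 (G : grpType) (X : subgroup_family G) (n : option nat) (A : omod X)
    (P : proj_res A) :
  (bredon_FP n A <->
     (forall (L : dirset) (S : osys X L) (k : nat),
        (ltn_ext k n -> bijective (ext_lim_map S P k)) /\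
        (n = Some k -> injective (ext_lim_map S P k))))
  /\
  (bredon_FP n A <->
     (forall (L : dirset) (S : osys X L),
        ozero (olim S) ->
        forall k : nat, leq_ext k n ->
        forall x : dlim (ext_sys S P k), x = 0)).
Proof.
have FP_lim : bredon_FP n A -> forall (L : dirset) (S : osys X L) (k : nat),
    (ltn_ext k n -> bijective (ext_lim_map S P k)) /\
    (n = Some k -> injective (ext_lim_map S P k)).
  move=> [Q Qfg] L S k; split=> kn; last first.
    by apply: (ext_lim_map_inj Qfg); rewrite kn /=.
  apply: inj_surj_bijective; first exact: ext_lim_map_inj Qfg _ _ _ (ltn_extW kn).
  by move=> x; apply: (ext_lim_map_surj Qfg kn).
have lim_vanish : (forall (L : dirset) (S : osys X L) (k : nat),
      (ltn_ext k n -> bijective (ext_lim_map S P k)) /\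
      (n = Some k -> injective (ext_lim_map S P k))) ->
    forall (L : dirset) (S : osys X L), ozero (olim S) ->
    forall k : nat, leq_ext k n -> forall x : dlim (ext_sys S P k), x = 0.
  move=> lim L S S0 k kn x.
  (* Below [n] injectivity is part of bijectivity; at [k] equal to [n] it is the second clause. *)
  have k_inj : injective (ext_lim_map S P k).
    have [lim_bij lim_inj] := lim L S k.
    by have [/lim_inj|/lim_bij/bij_inj] := leq_ext_eqVlt kn.
  have ext0 (y : ext P k (olim S)) : y = 0.
    have [z ->] := ext_class_surj y; apply/ext_class_eq0.
    by rewrite (ozero_ohom (cocycle_val z) S0); exact: is_coboundary0.
  by apply: k_inj; rewrite [LHS]ext0 [RHS]ext0.
have vanish_FP : (forall (L : dirset) (S : osys X L), ozero (olim S) ->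
    forall k : nat, leq_ext k n -> forall x : dlim (ext_sys S P k), x = 0) ->
    bredon_FP n A.
  by move=> ext0; exists (cover_res A) => k kn; exact/cover_res_fg/(cover_syzygy_fg ext0).
by split; split=> [|?]; auto.
Qed.
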